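(* Let $d\ge 2$, $n\ge 2$, let $\mathcal G=(\mathcal V,\mathcal E)$ be an undirected graph with $\mathcal V=\{1,\dots,n\}$ and $m$ edges, and consider $n$ agents with $\dot p_i=v_i$, $\dot v_i=u_i$, $i=1,\dots,n$, where $p_i(t),v_i(t),u_i(t)\in\mathbb R^d$. Assume that: (1) agent $1$ is the leader, which can measure its own position $p_1$ and velocity $v_1$ (only $p_1$ is used below); (2) each agent $i$ measures, in a common inertial frame, the bearings $g_{ij}$ to its neighbors $j$, $(i,j)\in\mathcal E$, and can transmit its state estimates to its neighbors; (3) for every $i$, $p_i(t),v_i(t),u_i(t)$ are bounded over $t\ge0$, all bearings $g_{ij}(t)$, $(i,j)\in\mathcal E$, are well defined for all $t\ge0$, and the formation $\mathcal G(\boldsymbol p(t))$ is bearing persistently exciting (BPE); (4) the set of edge bearings $\bar g_k$ that are not persistently exciting (PE) is empty or composed of constant bearings. For each edge $k$ whose bearing $\bar g_k$ is PE, let $(\hat{\bar p}_k,\hat{\bar v}_k)$ be produced by the relative Riccati observer described in the context; for each other edge set $(\hat{\bar p}_k,\hat{\bar v}_k)=(0,0)$. Let $\hat{\bar{\boldsymbol p}}=[\hat{\bar p}_1^\top,\dots,\hat{\bar p}_m^\top]^\top$. Let $\kappa_{o_1},\kappa_{o_2}>0$, $\Lambda=\begin{bmatrix}\kappa_{o_1}I_{dn}\\ \kappa_{o_2}I_{dn}\end{bmatrix}$, and consider the distributed observer $$\begin{bmatrix}\dot{\hat{\boldsymbol p}}\\ \dot{\hat{\boldsymbol v}}\end{bmatrix}=A\begin{bmatrix}\hat{\boldsymbol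 p}\\ \hat{\boldsymbol v}\end{bmatrix}+B\boldsymbol u+\Lambda\Big(\bar H^\top\bar\Sigma\,(\hat{\bar{\boldsymbol p}}-\bar H\hat{\boldsymbol p})+C_1(\boldsymbol p-\hat{\boldsymbol p})\Big),$$ with $A=\begin{bmatrix}0_{dn} & I_{dn}\\ 0_{dn} & 0_{dn}\end{bmatrix}$, $B=\begin{bmatrix}0_{dn}\\ I_{dn}\end{bmatrix}$ and $C_1=\mathrm{blkdiag}(I_d,0_d,\dots,0_d)\in\mathbb R^{dn\times dn}$. Then the origin of the estimation error $(\boldsymbol\delta_p,\boldsymbol\delta_v):=(\hat{\boldsymbol p}-\boldsymbol p,\hat{\boldsymbol v}-\boldsymbol v)$ is globally exponentially stable.
   Context: Notation: $\boldsymbol p,\boldsymbol v,\boldsymbol u\in\mathbb R^{dn}$ are the stacked vectors of $p_i,v_i,u_i$, and $\hat{\boldsymbol p},\hat{\boldsymbol v}$ those of the estimates $\hat p_i,\hat v_i$; $I_k$, $0_k$ are the $k\times k$ identity and zero matrices. $X\ge Y$ means $X-Y$ is positive semidefinite. For $y\in S^{d-1}$ (the unit sphere in $\mathbb R^d$), $\pi_y:=I_d-yy^\top$. Bearings: for $(i,j)\in\mathcal E$, $p_{ij}:=p_j-p_i$ and, if $p_{ij}\ne0$, $g_{ij}:=p_{ij}/\|p_{ij}\|$. Fix an arbitrary orientation of the edges and number them $k=1,\dots,m$; if edge $k$ goes from $i$ to $j$, set $\bar p_k:=p_j-p_i$, $\bar v_k:=v_j-v_i$, $\bar u_k:=u_j-u_i$,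 $\bar g_k:=\bar p_k/\|\bar p_k\|$. $H\in\mathbb R^{m\times n}$ is the incidence matrix of the oriented graph (row $k$ has $-1$ in column $i$, $+1$ in column $j$, zeros elsewhere), $\bar H:=H\otimes I_d$, $L:=\bar H^\top\bar H$, and $L_B(\boldsymbol p):=\bar H^\top\mathrm{blkdiag}(\pi_{\bar g_1},\dots,\pi_{\bar g_m})\bar H$. PE: a direction $y(t)\in S^{d-1}$ is PE if there exist $T,\mu>0$ with $\frac1T\int_t^{t+T}\pi_{y(\tau)}d\tau\ge\mu I_d$ for all $t\ge0$. BPE: $\mathcal G(\boldsymbol p(t))$ is BPE if $\mathcal G$ is connected and there exist $T,\mu>0$ with $\frac1T\int_t^{t+T}L_B(\boldsymbol p(\tau))d\tau\ge\mu L$ for all $t\ge0$. $\bar\Sigma:=\mathrm{blkdiag}(\sigma_1,\dots,\sigma_m)$, with $\sigma_k=I_d$ if $\bar g_k$ is PE and $\sigma_k=\pi_{\bar g_k}$ otherwise. Relative Riccati observer for an edge $k$ with PE bearing: with $A_k=\begin{bmatrix}0_d & I_d\\ 0_d & 0_d\end{bmatrix}$, $B_k=\begin{bmatrix}0_d\\ I_d\end{bmatrix}$, $C_k(t)=\pi_{\bar g_k(t)}\begin{bmatrix}I_d&0_d\end{bmatrix}$, $$\begin{bmatrix}\dot{\hat{\bar p}}_k\\ \dot{\hat{\bar v}}_k\end{bmatrix}=A_k\begin{bmatrix}\hat{\bar p}_k\\ \hat{\bar v}_k\end{bmatrix}+B_k\bar u_k-K_kC_k\begin{bmatrix}\hat{\bar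 p}_k\\ \hat{\bar v}_k\end{bmatrix},\qquad K_k=\kappa_kM_kC_k^\top Q_k,$$ where $\kappa_k\ge\frac12$, $Q_k\in\mathbb R^{d\times d}$ and $S_k\in\mathbb R^{2d\times2d}$ are symmetric positive definite matrices, and $M_k$ solves $\dot M_k=A_kM_k+M_kA_k^\top-M_kC_k^\top Q_kC_kM_k+S_k$ with $M_k(0)$ symmetric positive definite. *)

(* Defs.v *)
From HB Require Import structures.
From mathcomp Require Import all_boot all_order all_algebra.
From mathcomp Require Import all_classical all_reals all_analysis.
From mathcomp Require Export mxtens.

Set Implicit Arguments.
Unset Strict Implicit.
Unset Printing Implicit Defensive.

Import Order.TTheory GRing.Theory Num.Theory.
Import numFieldNormedType.Exports.

Local Open Scope classical_set_scope.
Local Open Scope ring_scope.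

(* The norm `|x| that the library puts on matrices is the sup norm; bearings
   need the Euclidean one. *)
Definition enorm (R : realType) (n : nat) (x : 'cV[R]_n) : R :=
  Num.sqrt (\sum_i x i 0 ^+ 2).

Definition psdmx (R : realType) (n : nat) (X : 'M[R]_n) : Prop :=
  X^T = X /\ forall x : 'cV[R]_n, 0 <= (x^T *m X *m x) 0 0.

Definition pdmx (R : realType) (n : nat) (X : 'M[R]_n) : Prop :=
  X^T = X /\ forall x : 'cV[R]_n, x != 0 -> 0 < (x^T *m X *m x) 0 0.

Definition loewner_ge (R : realType) (n : nat) (X Y : 'M[R]_n) : Prop :=
  psdmx (X - Y).

Definition intmx (R : realType) (m n : nat) (X : R -> 'M[R]_(m, n)) (a b : R) :
    'M[R]_(m, n) :=
  \matrix_(i, j) \int[lebesgue_measure]_(s in `[a, b]) X s i j.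

(* x' = F on the time interval [t0, +oo[.  Only continuity is asked at the
   initial time, so the values of x before t0 are irrelevant. *)
Definition solution (R : realType) (m n : nat) (t0 : R)
    (x F : R -> 'M[R]_(m, n)) : Prop :=
  {within `[t0, +oo[, continuous x} /\
  forall t, t0 < t -> is_derive t 1 x (F t).

(* In a stacked vector of n blocks of size d, coordinate a of block i has index
   mxtens_index (i, a), which is also the indexing of the Kronecker product
   A *t B. *)
Definition stack (R : realType) (n d : nat) (x : 'I_n -> 'cV[R]_d) :
    'cV[R]_(n * d) :=
  \col_a x (mxtens_unindex a).1 (mxtens_unindex a).2 0.

Definition blkdiag (R : realType) (n d : nat) (X : 'I_n -> 'M[R]_d) :
    'M[R]_(n * d) :=
  \sum_i delta_mx i i *t X i.

Definition orth_proj (R : realType) (d : nat) (y : 'cV[R]_d) : 'M[R]_d :=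
  1%:M - y *m y^T.

Definition bearing (R : realType) (d : nat) (x : 'cV[R]_d) : 'cV[R]_d :=
  (enorm x)^-1 *: x.

Definition PE (R : realType) (d : nat) (y : R -> 'cV[R]_d) : Prop :=
  exists T mu : R, [/\ 0 < T, 0 < mu &
    forall t, 0 <= t ->
      loewner_ge (T^-1 *: intmx (fun s => orth_proj (y s)) t (t + T)) mu%:M].

Definition constant_direction (R : realType) (d : nat) (y : R -> 'cV[R]_d) :
    Prop :=
  exists y0 : 'cV[R]_d, forall t, 0 <= t -> y t = y0.

Definition bounded_signal (R : realType) (d : nat) (x : R -> 'cV[R]_d) : Prop :=
  exists b : R, forall t, 0 <= t -> enorm (x t) <= b.

Definition simple_graph (n : nat) (e : rel 'I_n) : Prop :=
  symmetric e /\ irreflexive e.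

Definition connected_graph (n : nat) (e : rel 'I_n) : Prop :=
  forall i j, connect e i j.

(* src and tgt number the edges by 'I_m and orient each of them; uniqueness of
   k makes m the number of (undirected) edges. *)
Definition edge_orientation (n m : nat) (e : rel 'I_n) (src tgt : 'I_m -> 'I_n) :
    Prop :=
  (forall k, e (src k) (tgt k)) /\
  forall i j, e i j ->
    exists! k, (src k, tgt k) = (i, j) \/ (src k, tgt k) = (j, i).

Definition incidence (R : realType) (n m : nat) (src tgt : 'I_m -> 'I_n) :
    'M[R]_(m, n) :=
  \matrix_(k, i) ((i == tgt k)%:R - (i == src k)%:R).

Definition Hbar (R : realType) (d n m : nat) (src tgt : 'I_m -> 'I_n) :
    'M[R]_(m * d, n * d) :=
  incidence R src tgt *t 1%:M.

Definition edge_diff (R : realType) (d n m : nat) (src tgt : 'I_m -> 'I_n)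
    (x : 'I_n -> R -> 'cV[R]_d) (k : 'I_m) (t : R) : 'cV[R]_d :=
  x (tgt k) t - x (src k) t.

Definition edge_bearing (R : realType) (d n m : nat) (src tgt : 'I_m -> 'I_n)
    (p : 'I_n -> R -> 'cV[R]_d) (k : 'I_m) (t : R) : 'cV[R]_d :=
  bearing (edge_diff src tgt p k t).

Definition laplacian (R : realType) (d n m : nat) (src tgt : 'I_m -> 'I_n) :
    'M[R]_(n * d) :=
  (Hbar R d src tgt)^T *m Hbar R d src tgt.

Definition bearing_laplacian (R : realType) (d n m : nat)
    (src tgt : 'I_m -> 'I_n) (p : 'I_n -> R -> 'cV[R]_d) (t : R) :
    'M[R]_(n * d) :=
  (Hbar R d src tgt)^T
    *m blkdiag (fun k => orth_proj (edge_bearing src tgt p k t))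
    *m Hbar R d src tgt.

Definition BPE (R : realType) (d n m : nat) (e : rel 'I_n)
    (src tgt : 'I_m -> 'I_n) (p : 'I_n -> R -> 'cV[R]_d) : Prop :=
  connected_graph e /\
  exists T mu : R, [/\ 0 < T, 0 < mu &
    forall t, 0 <= t ->
      loewner_ge (T^-1 *: intmx (bearing_laplacian src tgt p) t (t + T))
                 (mu *: laplacian R d src tgt)].

Definition Sigma_bar (R : realType) (d n m : nat) (src tgt : 'I_m -> 'I_n)
    (p : 'I_n -> R -> 'cV[R]_d) (t : R) : 'M[R]_(m * d) :=
  blkdiag (fun k => if `[< PE (edge_bearing src tgt p k) >] then 1%:M
                    else orth_proj (edge_bearing src tgt p k t)).

Definition integrator_A (R : realType) (N : nat) : 'M[R]_(N + N) :=
  block_mx 0 1%:M 0 0.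

Definition integrator_B (R : realType) (N : nat) : 'M[R]_(N + N, N) :=
  col_mx 0 1%:M.

Definition output_C (R : realType) (d : nat) (g : 'cV[R]_d) :
    'M[R]_(d, d + d) :=
  orth_proj g *m row_mx 1%:M 0.

Definition riccati_solution (R : realType) (d : nat) (g : R -> 'cV[R]_d)
    (Q : 'M[R]_d) (S : 'M[R]_(d + d)) (M : R -> 'M[R]_(d + d)) : Prop :=
  pdmx (M 0) /\
  solution 0 M (fun t =>
    integrator_A R d *m M t + M t *m (integrator_A R d)^T
    - M t *m (output_C (g t))^T *m Q *m output_C (g t) *m M t + S).

Definition riccati_gain (R : realType) (d : nat) (g : R -> 'cV[R]_d)
    (kappa : R) (Q : 'M[R]_d) (M : R -> 'M[R]_(d + d)) (t : R) :
    'M[R]_(d + d, d) :=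
  kappa *: (M t *m (output_C (g t))^T *m Q).

(* There is no measurement in the innovation: the output C_k(t) applied to the
   true relative state is pi_g pbar = 0. *)
Definition relative_observer (R : realType) (d : nat) (t0 : R)
    (g ub : R -> 'cV[R]_d) (kappa : R) (Q : 'M[R]_d)
    (M : R -> 'M[R]_(d + d)) (pb vb : R -> 'cV[R]_d) : Prop :=
  solution t0 (fun t => col_mx (pb t) (vb t)) (fun t =>
    integrator_A R d *m col_mx (pb t) (vb t) + integrator_B R d *m ub t
    - riccati_gain g kappa Q M t *m output_C (g t) *m col_mx (pb t) (vb t)).

Definition edge_estimator (R : realType) (d n m : nat) (src tgt : 'I_m -> 'I_n)
    (p u : 'I_n -> R -> 'cV[R]_d) (kappa : 'I_m -> R) (Q : 'I_m -> 'M[R]_d)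
    (M : 'I_m -> R -> 'M[R]_(d + d)) (t0 : R)
    (pb vb : 'I_m -> R -> 'cV[R]_d) : Prop :=
  forall k,
    let g := edge_bearing src tgt p k in
    (PE g -> relative_observer t0 g (edge_diff src tgt u k)
               (kappa k) (Q k) (M k) (pb k) (vb k)) /\
    (~ PE g -> forall t, t0 <= t -> pb k t = 0 /\ vb k t = 0).

(* The leader is the agent of index 0. *)
Definition leader_C (R : realType) (d n : nat) : 'M[R]_(n * d) :=
  blkdiag (fun i : 'I_n => if i == 0%N :> nat then 1%:M else 0 : 'M[R]_d).

Definition distributed_observer (R : realType) (d n m : nat)
    (src tgt : 'I_m -> 'I_n) (p u : 'I_n -> R -> 'cV[R]_d) (ko1 ko2 : R)
    (t0 : R) (pb : 'I_m -> R -> 'cV[R]_d) (ph vh : R -> 'cV[R]_(n * d)) :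
    Prop :=
  let H := Hbar R d src tgt in
  let Lambda : 'M[R]_(n * d + n * d, n * d) := col_mx ko1%:M ko2%:M in
  solution t0 (fun t => col_mx (ph t) (vh t)) (fun t =>
    integrator_A R (n * d) *m col_mx (ph t) (vh t)
    + integrator_B R (n * d) *m stack (u^~ t)
    + Lambda *m (H^T *m Sigma_bar src tgt p t
                   *m (stack (pb^~ t) - H *m ph t)
                 + leader_C R d n *m (stack (p^~ t) - ph t))).

Definition agent_error (R : realType) (d n : nat) (p v : 'I_n -> R -> 'cV[R]_d)
    (ph vh : R -> 'cV[R]_(n * d)) (t : R) : 'cV[R]_(n * d + n * d) :=
  col_mx (ph t - stack (p^~ t)) (vh t - stack (v^~ t)).

(* Edges whose bearing is not PE carry no relative observer, hence no error
   state. *)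
Definition edge_error (R : realType) (d n m : nat) (src tgt : 'I_m -> 'I_n)
    (p v : 'I_n -> R -> 'cV[R]_d) (pb vb : 'I_m -> R -> 'cV[R]_d) (t : R) :
    'cV[R]_(m * (d + d)) :=
  stack (fun k => if `[< PE (edge_bearing src tgt p k) >]
                  then col_mx (pb k t - edge_diff src tgt p k t)
                              (vb k t - edge_diff src tgt v k t)
                  else 0).

(* The dynamics of the agents' error are driven by the errors of the relative
   observers; the state of the resulting unforced time-varying error system
   is the pair of both. *)
Definition error_trajectory (R : realType) (d n m : nat)
    (src tgt : 'I_m -> 'I_n) (p v u : 'I_n -> R -> 'cV[R]_d)
    (kappa : 'I_m -> R) (Q : 'I_m -> 'M[R]_d) (M : 'I_m -> R -> 'M[R]_(d + d))
    (ko1 ko2 : R) (t0 : R)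
    (err : R -> 'cV[R]_((n * d + n * d) + m * (d + d))) : Prop :=
  exists (pb vb : 'I_m -> R -> 'cV[R]_d) (ph vh : R -> 'cV[R]_(n * d)),
    [/\ edge_estimator src tgt p u kappa Q M t0 pb vb,
        distributed_observer src tgt p u ko1 ko2 t0 pb ph vh &
        forall t, t0 <= t ->
          err t = col_mx (agent_error p v ph vh t)
                         (edge_error src tgt p v pb vb t)].

(* traj t0 x means that x is a trajectory of the system on [t0, +oo[. *)
Definition globally_exponentially_stable (R : realType) (N : nat)
    (traj : R -> (R -> 'cV[R]_N) -> Prop) : Prop :=
  exists c lambda : R, [/\ 0 < c, 0 < lambda &
    forall (t0 : R) (x : R -> 'cV[R]_N), 0 <= t0 -> traj t0 x ->
      forall t, t0 <= t ->
        enorm (x t) <= c * expR (- (lambda * (t - t0))) * enorm (x t0)].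

(* Main.v *)
Require Import Defs.
From mathcomp Require Import all_boot all_order all_algebra.
From mathcomp Require Import all_classical all_reals all_analysis.
From mathcomp Require Import ring lra.

(* Write W_k = x_k^T M_k^-1 x_k for the error x_k of the relative observer of a
   PE edge.  The Riccati equation gives W_k' <= - xi^T S_k xi with
   xi = M_k^-1 x_k, so W_k decays exponentially once M_k is bounded from above
   and from below, uniformly in time.  The upper bound rests on uniform
   observability, which holds without any bound on the speed of the bearing: a
   vector moving along a line can stay parallel to the bearing over one window
   of the PE condition, but not over two windows far enough apart.  As the
   non-PE bearings are constant, the agents' error (a, b) obeys
   a' = b + ko1 (f - P a), b' = ko2 (f - P a) with a constant matrix P, which
   BPE and the leader's measurement make positive definite, and an input f that
   is linear in the x_k.  A quadratic Lyapunov function V of this system plus a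
   large multiple of the sum of the W_k decays exponentially. *)

Set Implicit Arguments.
Unset Strict Implicit.
Unset Printing Implicit Defensive.

Import Order.TTheory GRing.Theory Num.Theory.
Import numFieldNormedType.Exports.

Local Open Scope classical_set_scope.
Local Open Scope ring_scope.

(** * Quadratic forms *)

(** [M_k] is given only as some solution of a matrix differential equation, so its symmetry,
    positivity and invertibility at later times must be proved before W_k makes sense. The lower
    bound comes from S_k: along a direction in which M_k is small, the terms of the equation that
    contain M_k are small as well, and S_k pushes the form back up. The condition kappa_k >= 1/2
    enters through the identity W_k' = - (2 kappa_k - 1) y^T Q_k y - xi^T S_k xi with y = C_k x_k. P
    is definite because its edge weights dominate the bearing projections at every time: the
    identity of a PE edge dominates any projection, and on the other edges the projection is
    constant; so a single BPE window is enough. The coupling is one-way, from the edges to the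
    agents, which is why a large multiple of the W_k can absorb f. Solutions are only continuous at
    their initial time, so the decay estimates that start there are proved after it and carried back
    by a limit. *)

Definition dot (R : realType) (n : nat) (x y : 'cV[R]_n) : R := (x^T *m y) 0 0.

Section dot.
Context {R : realType}.
Implicit Types n m : nat.

Lemma dotE n (x y : 'cV[R]_n) : dot x y = \sum_i x i 0 * y i 0.
Proof. by rewrite /dot mxE; apply: eq_bigr => i _; rewrite mxE. Qed.

Lemma dotC n (x y : 'cV[R]_n) : dot x y = dot y x.
Proof. by rewrite !dotE; apply: eq_bigr => i _; rewrite mulrC. Qed.

Lemma dotDr n (x y z : 'cV[R]_n) : dot x (y + z) = dot x y + dot x z.
Proof. by rewrite /dot mulmxDr mxE. Qed.

Lemma dotDl n (x y z : 'cV[R]_n) : dot (y + z) x = dot y x + dot z x.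
Proof. by rewrite dotC dotDr !(dotC x). Qed.

Lemma dotZr n a (x y : 'cV[R]_n) : dot x (a *: y) = a * dot x y.
Proof. by rewrite /dot -scalemxAr mxE. Qed.

Lemma dotZl n a (x y : 'cV[R]_n) : dot (a *: y) x = a * dot y x.
Proof. by rewrite dotC dotZr dotC. Qed.

Lemma dotNr n (x y : 'cV[R]_n) : dot x (- y) = - dot x y.
Proof. by rewrite /dot mulmxN mxE. Qed.

Lemma dotNl n (x y : 'cV[R]_n) : dot (- y) x = - dot y x.
Proof. by rewrite dotC dotNr dotC. Qed.

Lemma dotBr n (x y z : 'cV[R]_n) : dot x (y - z) = dot x y - dot x z.
Proof. by rewrite dotDr dotNr. Qed.

Lemma dotBl n (x y z : 'cV[R]_n) : dot (y - z) x = dot y x - dot z x.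
Proof. by rewrite dotDl dotNl. Qed.

Lemma dot0r n (x : 'cV[R]_n) : dot x 0 = 0.
Proof. by rewrite /dot mulmx0 mxE. Qed.

Lemma dot0l n (x : 'cV[R]_n) : dot 0 x = 0.
Proof. by rewrite dotC dot0r. Qed.

Lemma dot_mulmxr n m (A : 'M[R]_(n, m)) x y : dot x (A *m y) = dot (A^T *m x) y.
Proof. by rewrite /dot trmx_mul trmxK mulmxA. Qed.

Lemma quadE n (X : 'M[R]_n) (x : 'cV[R]_n) :
  (x^T *m X *m x) 0 0 = dot x (X *m x).
Proof. by rewrite /dot mulmxA. Qed.

Lemma dot_ge0 n (x : 'cV[R]_n) : 0 <= dot x x.
Proof. by rewrite dotE; apply: sumr_ge0 => i _; rewrite -expr2 sqr_ge0. Qed.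

Lemma dot_eq0 n (x : 'cV[R]_n) : (dot x x == 0) = (x == 0).
Proof.
apply/eqP/eqP => [|->]; last by rewrite dot0r.
rewrite dotE => /eqP; rewrite psumr_eq0 => [/allP h|i _]; last first.
  by rewrite -expr2 sqr_ge0.
apply/matrixP => i j; rewrite ord1 mxE; apply/eqP.
by have := h i (mem_index_enum i); rewrite mulf_eq0 orbb.
Qed.

Lemma dot_gt0 n (x : 'cV[R]_n) : (0 < dot x x) = (x != 0).
Proof. by rewrite lt_def dot_eq0 dot_ge0 andbT. Qed.

Lemma dot_col_mx n m (x1 y1 : 'cV[R]_n) (x2 y2 : 'cV[R]_m) :
  dot (col_mx x1 x2) (col_mx y1 y2) = dot x1 y1 + dot x2 y2.
Proof. by rewrite /dot tr_col_mx mul_row_col mxE. Qed.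

Lemma enorm_ge0 n (x : 'cV[R]_n) : 0 <= enorm x.
Proof. exact: sqrtr_ge0. Qed.

Lemma enorm_sqr n (x : 'cV[R]_n) : enorm x ^+ 2 = dot x x.
Proof.
rewrite /enorm sqr_sqrtr; last by apply: sumr_ge0 => i _; exact: sqr_ge0.
by rewrite dotE; apply: eq_bigr => i _; rewrite expr2.
Qed.

Lemma dot_young n (c : R) (x y : 'cV[R]_n) : 0 < c ->
  2 * dot x y <= c * dot x x + c^-1 * dot y y.
Proof.
move=> c0; have := dot_ge0 (c *: x - y).
rewrite dotBl !dotBr !dotZr !dotZl (dotC y x) => h.
suff : 0 <= c * (c * dot x x + c^-1 * dot y y - 2 * dot x y).
  by rewrite pmulr_rge0// subr_ge0.
have -> : c * (c * dot x x + c^-1 * dot y y - 2 * dot x y) =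
  c * (c * dot x x) - c * dot x y - (c * dot x y - dot y y).
  by field; rewrite gt_eqF.
exact: h.
Qed.

Lemma dot_youngN n (c : R) (x y : 'cV[R]_n) : 0 < c ->
  - (2 * dot x y) <= c * dot x x + c^-1 * dot y y.
Proof.
by move=> c0; have := dot_young x (- y) c0; rewrite !dotNr dotNl opprK mulrN.
Qed.

Lemma dotD_le n (x y : 'cV[R]_n) :
  dot (x + y) (x + y) <= 2 * dot x x + 2 * dot y y.
Proof.
have := dot_young x y (@ltr01 R).
by rewrite invr1 !mul1r !dotDl !dotDr (dotC y x); lra.
Qed.

Lemma dotD_ge n (x y : 'cV[R]_n) :
  2^-1 * dot x x - dot y y <= dot (x + y) (x + y).
Proof.
have h : 0 < 2^-1 :> R by rewrite invr_gt0.
have := dot_youngN x y h; rewrite invrK !dotDl !dotDr (dotC y x); lra.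
Qed.

Lemma cauchy_schwarz n (x y : 'cV[R]_n) : dot x y ^+ 2 <= dot x x * dot y y.
Proof.
have [->|x0] := eqVneq x 0; first by rewrite !dot0l expr2 !mul0r.
have x1 : 0 < dot x x by rewrite dot_gt0.
have := dot_ge0 (dot x x *: y - dot x y *: x).
rewrite dotBl !dotBr !dotZr !dotZl (dotC y x) => h.
rewrite -subr_ge0 -(pmulr_rge0 _ x1).
by move: h; congr (_ <= _); ring.
Qed.

(** The squared Frobenius norm. Being polynomial in the entries it is easy to differentiate; it is
    submultiplicative and dominates the squared operator norm. *)
Definition mxsq n m (A : 'M[R]_(n, m)) : R := \sum_i \sum_j A i j ^+ 2.

Lemma mxsq_ge0 n m (A : 'M[R]_(n, m)) : 0 <= mxsq A.
Proof. by do 2 apply: sumr_ge0 => ? _; exact: sqr_ge0. Qed.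

Lemma dot_mulmx_le n m (A : 'M[R]_(n, m)) x :
  dot (A *m x) (A *m x) <= mxsq A * dot x x.
Proof.
rewrite [X in X <= _]dotE /mxsq mulr_suml; apply: ler_sum => i _.
have -> : (A *m x) i 0 = dot (row i A)^T x.
  by rewrite dotE mxE; apply: eq_bigr => j _; rewrite !mxE.
rewrite -expr2; apply: le_trans (cauchy_schwarz _ _) _.
rewrite ler_wpM2r ?dot_ge0//= dotE; apply: ler_sum => j _.
by rewrite !mxE expr2.
Qed.

Lemma mxsq_le n m (A : 'M[R]_(n, m)) (B : R) :
  (forall i j, `|A i j| <= B) -> mxsq A <= (n * m)%:R * B ^+ 2.
Proof.
move=> AB; have -> : (n * m)%:R * B ^+ 2 = \sum_(i < n) \sum_(j < m) B ^+ 2.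
  by rewrite !sumr_const !card_ord -!mulrnA [LHS]mulr_natl mulnC.
apply: ler_sum => i _; apply: ler_sum => j _.
rewrite -real_normK ?num_real// lerXn2r ?nnegrE//.
exact: le_trans (AB i j).
Qed.

Lemma mxsq_mul n m k (A : 'M[R]_(n, m)) (B : 'M[R]_(m, k)) :
  mxsq (A *m B) <= mxsq A * mxsq B.
Proof.
have E k' m' (C : 'M[R]_(m', k')) : mxsq C = \sum_j dot (col j C) (col j C).
  rewrite /mxsq exchange_big; apply: eq_bigr => j _; rewrite dotE.
  by apply: eq_bigr => i _; rewrite !mxE expr2.
rewrite !E mulr_sumr; apply: ler_sum => j _.
by have := dot_mulmx_le A (col j B); rewrite -E [col j B]colE mulmxA -colE.
Qed.

Lemma mxsqZ n m a (A : 'M[R]_(n, m)) : mxsq (a *: A) = a ^+ 2 * mxsq A.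
Proof.
rewrite /mxsq mulr_sumr; apply: eq_bigr => i _; rewrite mulr_sumr.
by apply: eq_bigr => j _; rewrite mxE exprMn.
Qed.

Lemma mxsqD n m (A B : 'M[R]_(n, m)) : mxsq (A + B) <= 2 * mxsq A + 2 * mxsq B.
Proof.
rewrite /mxsq !mulr_sumr -big_split; apply: ler_sum => i _ /=.
rewrite !mulr_sumr -big_split; apply: ler_sum => j _ /=; rewrite mxE.
by have := sqr_ge0 (A i j - B i j); rewrite !expr2; lra.
Qed.

Lemma mxsq_tr n m (A : 'M[R]_(n, m)) : mxsq A^T = mxsq A.
Proof.
rewrite /mxsq exchange_big; apply: eq_bigr => i _; apply: eq_bigr => j _.
by rewrite mxE.
Qed.

(** Young's inequality with weight 1 gives this constant without a square root. *)
Lemma quad_le n (A : 'M[R]_n) (x : 'cV[R]_n) :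
  `|dot x (A *m x)| <= (1 + mxsq A) * dot x x.
Proof.
have h1 := dot_young x (A *m x) (@ltr01 R).
have h2 := dot_youngN x (A *m x) (@ltr01 R).
have h3 := dot_mulmx_le A x; have := dot_ge0 x; have := dot_ge0 (A *m x).
by move: h1 h2; rewrite invr1 !mul1r => *; rewrite ler_norml; apply/andP; split;
  lra.
Qed.

Lemma psd_cauchy_schwarz n (X : 'M[R]_n) (x y : 'cV[R]_n) : psdmx X ->
  dot x (X *m y) ^+ 2 <= dot x (X *m x) * dot y (X *m y).
Proof.
move=> [sX pX]; have pX' z : 0 <= dot z (X *m z) by rewrite -quadE.
have sym a b : dot a (X *m b) = dot b (X *m a) by rewrite dot_mulmxr sX dotC.
have key (s : R) : 0 <= dot x (X *m x) + 2 * s * dot x (X *m y)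
    + s ^+ 2 * dot y (X *m y).
  have := pX' (x + s *: y).
  rewrite !mulmxDr -!scalemxAr !dotDl !dotDr !dotZl !dotZr (sym y x).
  by congr (_ <= _); ring.
(* The discriminant argument on the polynomial in [s]. If the form vanishes at [y] the polynomial is
   affine, and the [s] below sends it to -1 unless its slope is zero; otherwise the minimizing [s]
   is inserted. *)
have [y0|y0] := eqVneq (dot y (X *m y)) 0.
  rewrite y0 mulr0; have [->|h] := eqVneq (dot x (X *m y)) 0.
    by rewrite expr2 mul0r.
  have := key (- (dot x (X *m x) + 1) / (2 * dot x (X *m y))).
  rewrite y0; have -> : dot x (X *m x) +
    2 * (- (dot x (X *m x) + 1) / (2 * dot x (X *m y))) * dot x (X *m y) +
    (- (dot x (X *m x) + 1) / (2 * dot x (X *m y))) ^+ 2 * 0 = -1.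
    by field.
  by rewrite oppr_ge0 ler10.
have yp : 0 < dot y (X *m y) by rewrite lt_def y0 pX'.
rewrite -subr_ge0; have -> : dot x (X *m x) * dot y (X *m y) -
    dot x (X *m y) ^+ 2 = dot y (X *m y) * (dot x (X *m x) +
    2 * (- dot x (X *m y) / dot y (X *m y)) * dot x (X *m y) +
    (- dot x (X *m y) / dot y (X *m y)) ^+ 2 * dot y (X *m y)).
  by field.
by rewrite mulr_ge0 ?key ?ltW.
Qed.

Lemma psd_ker n (X : 'M[R]_n) (x : 'cV[R]_n) : psdmx X ->
  dot x (X *m x) = 0 -> X *m x = 0.
Proof.
move=> pX x0; apply/eqP; rewrite -dot_eq0.
have := psd_cauchy_schwarz (X *m x) x pX.
by rewrite x0 mulr0 => h; rewrite -sqrf_eq0 eq_le h sqr_ge0.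
Qed.

(** Cauchy-Schwarz for the form [X] at the vectors [X *m x] and [x], followed by cancelling one
    factor |X x|^2. *)
Lemma psd_mul_le n (X : 'M[R]_n) (x : 'cV[R]_n) : psdmx X ->
  dot (X *m x) (X *m x) <= (1 + mxsq X) * dot x (X *m x).
Proof.
move=> pX; have [->|x0] := eqVneq (X *m x) 0.
  by rewrite !dot0r mulr0.
have x1 : 0 < dot (X *m x) (X *m x) by rewrite dot_gt0.
have h1 := psd_cauchy_schwarz (X *m x) x pX.
have h2 := quad_le X (X *m x).
have h3 : 0 <= dot x (X *m x) by rewrite -quadE; exact: pX.2.
rewrite -(ler_pM2l x1) -expr2; apply: le_trans h1 _.
rewrite mulrCA mulrA ler_wpM2r//; apply: le_trans h2.
exact: ler_norm.
Qed.

Lemma pd_psd n (X : 'M[R]_n) : pdmx X -> psdmx X.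
Proof.
move=> [sX pX]; split=> // x; have [->|/pX/ltW//] := eqVneq x 0.
by rewrite quadE dot0l.
Qed.

Lemma unitmx_ker n (X : 'M[R]_n) :
  (forall x : 'cV[R]_n, X *m x = 0 -> x = 0) -> X \in unitmx.
Proof.
move=> kerX; rewrite -unitmx_tr -row_free_unit -kermx_eq0.
apply/eqP/row_matrixP => i; rewrite row0.
have h : row i (kermx X^T) *m X^T = 0 by apply/sub_kermxP/row_sub.
apply/trmx_inj; rewrite trmx0; apply: kerX.
by apply/trmx_inj; rewrite trmx_mul trmxK h trmx0.
Qed.

Lemma coercive_unit n (X : 'M[R]_n) (c : R) : 0 < c ->
  (forall x, c * dot x x <= dot x (X *m x)) -> X \in unitmx.
Proof.
move=> c0 cX; apply: unitmx_ker => x Xx; apply/eqP; rewrite -dot_eq0.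
have := cX x; rewrite Xx dot0r pmulr_rle0// => h.
by rewrite eq_le h dot_ge0.
Qed.

(** No eigenvalue or compactness is used: |x|^2 is at most a multiple of |X x|^2 because [X] is
    invertible, and |X x|^2 is at most a multiple of x^T X x by [psd_mul_le]. The summands 1 in [K]
    keep it positive in dimension 0 too. *)
Lemma pd_coercive n (X : 'M[R]_n) : pdmx X ->
  exists2 c : R, 0 < c & forall x, c * dot x x <= dot x (X *m x).
Proof.
move=> pX; have uX : X \in unitmx.
  apply: unitmx_ker => x Xx; apply/eqP; apply: contraPT isT => /pX.2.
  by rewrite quadE Xx dot0r ltxx.
pose K := (1 + mxsq (invmx X)) * (1 + mxsq X).
have K0 : 0 < K by rewrite mulr_gt0// ltr_wpDr// mxsq_ge0.
exists K^-1; rewrite ?invr_gt0// => x.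
rewrite mulrC ler_pdivrMr//.
have h1 := dot_mulmx_le (invmx X) (X *m x).
rewrite mulKmx// in h1; apply: le_trans h1 _.
have h2 := psd_mul_le x (pd_psd pX).
apply: le_trans (ler_wpM2l (mxsq_ge0 _) h2) _.
rewrite mulrA [leRHS]mulrC ler_wpM2r//.
  by rewrite -quadE; exact: (pd_psd pX).2.
by rewrite ler_wpM2r ?lerDr// addr_ge0// mxsq_ge0.
Qed.

Lemma coercive_mulmx_ge n (X : 'M[R]_n) (c : R) x : 0 < c ->
  c * dot x x <= dot x (X *m x) -> c ^+ 2 * dot x x <= dot (X *m x) (X *m x).
Proof.
move=> c0 h; have := dot_young x (X *m x) c0.
move=> h1; have h2 : c * dot x x <= c^-1 * dot (X *m x) (X *m x) by lra.
by rewrite expr2 -mulrA -ler_pdivlMl.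
Qed.

Lemma coercive_invmx n (X : 'M[R]_n) (c : R) : 0 < c ->
  (forall x, c * dot x x <= dot x (X *m x)) ->
  forall x, dot (invmx X *m x) (invmx X *m x) <= (c ^+ 2)^-1 * dot x x.
Proof.
move=> c0 cX x; have uX := coercive_unit c0 cX.
have := coercive_mulmx_ge c0 (cX (invmx X *m x)).
by rewrite mulKVmx// mulrC -ler_pdivlMr ?exprn_gt0// mulrC.
Qed.

End dot.

(** * Derivatives of matrix functions *)

Section scalar_derivative.
Context {R : realType}.
Implicit Types (f g : R -> R) (t a b : R).

Lemma der_eq f t a b : is_derive t 1 f a -> a = b -> is_derive t 1 f b.
Proof. by move=> ? <-. Qed.

Lemma derD f g t a b : is_derive t 1 f a -> is_derive t 1 g b ->
  is_derive t 1 (fun s => f s + g s) (a + b).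
Proof. exact: is_deriveD. Qed.

Lemma derN f t a : is_derive t 1 f a -> is_derive t 1 (fun s => - f s) (- a).
Proof. exact: is_deriveN. Qed.

Lemma derM f g t a b : is_derive t 1 f a -> is_derive t 1 g b ->
  is_derive t 1 (fun s => f s * g s) (a * g t + f t * b).
Proof.
move=> fa gb; apply: der_eq (is_deriveM fa gb) _.
by rewrite addrC [_ *: a]mulrC.
Qed.

Lemma der_cst (c t : R) : is_derive t 1 (fun=> c) (0 : R).
Proof. exact: is_derive_cst. Qed.

Lemma derZ c f t a : is_derive t 1 f a -> is_derive t 1 (fun s => c * f s) (c * a).
Proof.
move=> fa; apply: der_eq (derM (der_cst c t) fa) _.
by rewrite mul0r add0r.
Qed.

Lemma der_id t : is_derive t 1 (fun s : R => s) 1.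
Proof. exact: is_derive_id. Qed.

Lemma der_sum n (f : 'I_n -> R -> R) (a : 'I_n -> R) t :
  (forall i, is_derive t 1 (f i) (a i)) ->
  is_derive t 1 (fun s => \sum_i f i s) (\sum_i a i).
Proof.
move=> fa; have -> : (fun s => \sum_i f i s) = \sum_i f i.
  by apply/funext => s; rewrite fct_sumE.
exact: is_derive_sum.
Qed.

Lemma der_continuous f t a : is_derive t 1 f a -> {for t, continuous f}.
Proof. by move=> [fa _]; exact/differentiable_continuous/derivable1_diffP. Qed.

Lemma mvt_der f (f' : R -> R) a b : a < b ->
  (forall s, a <= s <= b -> is_derive s 1 f (f' s)) ->
  exists2 c, a < c < b & f b - f a = f' c * (b - a).
Proof.
move=> ab df; have [|c|c cab fc] := @MVT R f f' a b ab.
- by move=> s; rewrite in_itv/= => /andP[? ?]; apply: df; rewrite !ltW.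
- apply: derivable_within_continuous => s; rewrite in_itv/= => sab.
  by case: (df _ sab).
by exists c => //; move: cab; rewrite in_itv.
Qed.

Lemma der_ub f (f' : R -> R) k a b : a <= b ->
  (forall s, a <= s <= b -> is_derive s 1 f (f' s)) ->
  (forall s, a <= s <= b -> f' s <= k) -> f b - f a <= k * (b - a).
Proof.
rewrite le_eqVlt => /predU1P[<-|ab df fk]; first by rewrite !subrr mulr0.
have [c /andP[ac cb] ->] := mvt_der ab df.
apply: ler_wpM2r; first by rewrite subr_ge0 ltW.
by apply: fk; rewrite !ltW.
Qed.

Lemma der_lb f (f' : R -> R) k a b : a <= b ->
  (forall s, a <= s <= b -> is_derive s 1 f (f' s)) ->
  (forall s, a <= s <= b -> k <= f' s) -> k * (b - a) <= f b - f a.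
Proof.
move=> ab df fk; have := @der_ub (fun s => - f s) (fun s => - f' s) (- k) a b ab.
rewrite mulNr -opprD lerN2; apply=> s sab; first exact/derN/df.
by rewrite lerN2 fk.
Qed.

(** The function exp(l s) f(s) does not increase. The rate [l] may be negative, and then this is a
    Gronwall bound on growth. *)
Lemma der_exp_decay f (f' : R -> R) l a b : a <= b ->
  (forall s, a <= s <= b -> is_derive s 1 f (f' s)) ->
  (forall s, a <= s <= b -> f' s <= - l * f s) ->
  f b <= expR (- (l * (b - a))) * f a.
Proof.
move=> ab df fl.
have dexp (s : R) : is_derive s 1 (fun s : R => expR (l * s)) (expR (l * s) * l).
  have h : is_derive s 1 (fun s : R => l * s) l.
    by have := derZ l (der_id s); rewrite mulr1.
  exact: (is_derive1_comp (is_derive_expR (l * s)) h).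
have := @der_ub (fun s => expR (l * s) * f s)
  (fun s => expR (l * s) * l * f s + expR (l * s) * f' s) 0 a b ab.
rewrite mul0r subr_le0 => h.
suff h2 : expR (l * b) * f b <= expR (l * a) * f a.
  rewrite -(ler_pM2l (expR_gt0 (l * b))) mulrA -expRD.
  by have -> : l * b - l * (b - a) = l * a by ring.
apply: h => s sab; first exact: derM (dexp s) (df _ sab).
rewrite -mulrA -mulrDr pmulr_rle0 ?expR_gt0//.
by have := fl _ sab; rewrite mulNr; lra.
Qed.

Lemma exp_decay (f : R -> R) (l a b : R) : a <= b ->
  (forall s, a <= s <= b ->
    exists2 v, is_derive s 1 f v & v <= - l * f s) ->
  f b <= expR (- (l * (b - a))) * f a.
Proof.
move=> ab df; have /choice[f' Hf'] : forall s : R, exists v : R, a <= s <= b ->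
    is_derive s 1 f v /\ v <= - l * f s.
  move=> s; have [/df[v ? ?]|hs] := boolP (a <= s <= b); first by exists v.
  by exists 0.
by apply: (der_exp_decay ab) => s hs; [exact: (Hf' s hs).1|exact: (Hf' s hs).2].
Qed.

(** Needed because [solution] gives no derivative at the initial time: an estimate proved just after
    it is carried back by continuity. *)
Lemma right_limit_le f t0 t B : t0 < t ->
  {within `[t0, +oo[, continuous f} ->
  (forall s, t0 < s < t -> B <= f s) -> B <= f t0.
Proof.
move=> t0t /continuous_within_itvcyP[_ cf] Bf.
apply: (cvgr_to_ge cf); near=> s; apply: Bf; apply/andP; split => //.
Unshelve. all: by end_near. Qed.

Lemma within_bounded f a b : a <= b -> {within `[a, +oo[, continuous f} ->
  exists B, forall s, a <= s <= b -> `|f s| <= B.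
Proof.
move=> ab cf; have cf' : {within `[a, b], continuous f}.
  apply: continuous_subspaceW cf => s /=; rewrite !in_itv/= => /andP[-> _] //.
have [c _ fc] := EVT_max ab cf'; have [c' _ fc'] := EVT_min ab cf'.
exists (`|f c| + `|f c'|) => s sab.
have sab' : s \in `[a, b] by rewrite in_itv.
have := fc _ sab'; have := fc' _ sab'.
have := ler_norm (f c); have := ler_norm (- f c'); rewrite normrN.
have := normr_ge0 (f c); have := normr_ge0 (f c').
by rewrite ler_norml => *; apply/andP; split; lra.
Qed.

End scalar_derivative.

(** Entrywise, so that matrix calculus reduces to finite sums and products of scalar functions. *)
Definition mxder (R : realType) (m n : nat) (X : R -> 'M[R]_(m, n)) (t : R)
    (X' : 'M[R]_(m, n)) : Prop :=
  forall i j, is_derive t 1 (fun s => X s i j) (X' i j).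

Definition mxcont (R : realType) (m n : nat) (t0 : R)
    (X : R -> 'M[R]_(m, n)) : Prop :=
  forall i j, {within `[t0, +oo[, continuous (fun s => X s i j)}.

Section matrix_derivative.
Context {R : realType}.
Implicit Types (m n p : nat) (t : R).

Lemma solution_mxder m n t0 (x F : R -> 'M[R]_(m, n)) t :
  solution t0 x F -> t0 < t -> mxder x t (F t).
Proof.
move=> [_ dx] /dx [dxt Fx] i j; constructor; first exact: (derivable_mxP _ _ _).1.
by rewrite -Fx derive_mx// mxE.
Qed.

Lemma solution_mxcont m n t0 (x F : R -> 'M[R]_(m, n)) :
  solution t0 x F -> mxcont t0 x.
Proof.
move=> [cx _] i j s; apply: (@continuous_comp (subspace `[t0, +oo[) _ _ x
  (fun A : 'M[R]_(m, n) => A i j)); first exact: cx.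
exact: coord_continuous.
Qed.

Lemma mxder_eq m n (X : R -> 'M[R]_(m, n)) t X' Y' :
  mxder X t X' -> X' = Y' -> mxder X t Y'.
Proof. by move=> ? <-. Qed.

Lemma mxder_cst m n (A : 'M[R]_(m, n)) t : mxder (fun=> A) t 0.
Proof. by move=> i j; rewrite mxE; exact: der_cst. Qed.

Lemma mxder_near m n (X Y : R -> 'M[R]_(m, n)) t X' :
  (\near t, X t = Y t) -> mxder X t X' -> mxder Y t X'.
Proof.
move=> XY dX i j; apply: near_eq_is_derive (dX i j).
by apply: filterS XY => s ->.
Qed.

Lemma mxderD m n (X Y : R -> 'M[R]_(m, n)) t X' Y' :
  mxder X t X' -> mxder Y t Y' -> mxder (fun s => X s + Y s) t (X' + Y').
Proof.
move=> dX dY i j; rewrite mxE.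
under eq_fun do rewrite mxE; exact: derD.
Qed.

Lemma mxderN m n (X : R -> 'M[R]_(m, n)) t X' :
  mxder X t X' -> mxder (fun s => - X s) t (- X').
Proof.
move=> dX i j; rewrite mxE.
under eq_fun do rewrite mxE; exact: derN.
Qed.

Lemma mxderB m n (X Y : R -> 'M[R]_(m, n)) t X' Y' :
  mxder X t X' -> mxder Y t Y' -> mxder (fun s => X s - Y s) t (X' - Y').
Proof. by move=> dX dY; exact/mxderD/mxderN. Qed.

Lemma mxderM m n p (X : R -> 'M[R]_(m, n)) (Y : R -> 'M[R]_(n, p)) t X' Y' :
  mxder X t X' -> mxder Y t Y' ->
  mxder (fun s => X s *m Y s) t (X' *m Y t + X t *m Y').
Proof.
move=> dX dY i j; rewrite !mxE -big_split /=.
under eq_fun do rewrite mxE; apply: der_sum => k; exact: derM.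
Qed.

Lemma mxderMl m n p (A : 'M[R]_(m, n)) (Y : R -> 'M[R]_(n, p)) t Y' :
  mxder Y t Y' -> mxder (fun s => A *m Y s) t (A *m Y').
Proof.
by move=> dY; have := mxderM (mxder_cst A t) dY; rewrite mul0mx add0r.
Qed.

Lemma mxderMr m n p (A : 'M[R]_(n, p)) (Y : R -> 'M[R]_(m, n)) t Y' :
  mxder Y t Y' -> mxder (fun s => Y s *m A) t (Y' *m A).
Proof.
by move=> dY; have := mxderM dY (mxder_cst A t); rewrite mulmx0 addr0.
Qed.

Lemma mxderZ m n (f : R -> R) (X : R -> 'M[R]_(m, n)) t a X' :
  is_derive t 1 f a -> mxder X t X' ->
  mxder (fun s => f s *: X s) t (a *: X t + f t *: X').
Proof.
move=> df dX i j; rewrite !mxE.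
under eq_fun do rewrite mxE; exact: derM.
Qed.

Lemma mxder_tr m n (X : R -> 'M[R]_(m, n)) t X' :
  mxder X t X' -> mxder (fun s => (X s)^T) t X'^T.
Proof. by move=> dX i j; rewrite mxE; under eq_fun do rewrite mxE. Qed.

Lemma mxder_usub m1 m2 n (X : R -> 'M[R]_(m1 + m2, n)) t X' :
  mxder X t X' -> mxder (fun s => usubmx (X s)) t (usubmx X').
Proof. by move=> dX i j; rewrite mxE; under eq_fun do rewrite mxE. Qed.

Lemma mxder_dsub m1 m2 n (X : R -> 'M[R]_(m1 + m2, n)) t X' :
  mxder X t X' -> mxder (fun s => dsubmx (X s)) t (dsubmx X').
Proof. by move=> dX i j; rewrite mxE; under eq_fun do rewrite mxE. Qed.

Lemma mxder_col m1 m2 n (X : R -> 'M[R]_(m1, n)) (Y : R -> 'M[R]_(m2, n)) t X' Y' :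
  mxder X t X' -> mxder Y t Y' ->
  mxder (fun s => col_mx (X s) (Y s)) t (col_mx X' Y').
Proof.
move=> dX dY i j; rewrite mxE; under eq_fun do rewrite mxE.
by case: (fintype.split i) => k; [exact: dX|exact: dY].
Qed.

Lemma der_dot n (x y : R -> 'cV[R]_n) t x' y' :
  mxder x t x' -> mxder y t y' ->
  is_derive t 1 (fun s => dot (x s) (y s)) (dot x' (y t) + dot (x t) y').
Proof.
move=> dx dy; have := mxderM (mxder_tr dx) dy.
by move=> /(_ 0 0); rewrite mxE.
Qed.

Lemma der_quad n (X : R -> 'M[R]_n) (x : R -> 'cV[R]_n) t X' x' :
  mxder X t X' -> mxder x t x' ->
  is_derive t 1 (fun s => dot (x s) (X s *m x s))
    (dot x' (X t *m x t) + dot (x t) (X' *m x t + X t *m x')).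
Proof. by move=> dX dx; apply: der_dot => //; exact: mxderM. Qed.

Lemma der_quad_cst n (X : R -> 'M[R]_n) (x : 'cV[R]_n) t X' :
  mxder X t X' -> is_derive t 1 (fun s => dot x (X s *m x)) (dot x (X' *m x)).
Proof.
move=> dX; have := der_quad dX (mxder_cst x t).
by rewrite dot0l add0r mulmx0 addr0.
Qed.

Lemma derivable_bigsum (I : Type) (r : seq I) (f : I -> R -> R) t :
  (forall i, derivable (f i) t 1) -> derivable (fun s => \sum_(i <- r) f i s) t 1.
Proof.
move=> df; elim: r => [|i r IH].
  rewrite (_ : (fun s => _) = cst (0 : R)); first exact: derivable_cst.
  by apply/funext => s; rewrite big_nil.
rewrite (_ : (fun s => _) = f i + fun s => \sum_(j <- r) f j s).
  exact: (@derivableD _ _ _ (f i) _ t 1 (df i) IH).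
by apply/funext => s; rewrite big_cons.
Qed.

Lemma derivable_bigprod (I : Type) (r : seq I) (f : I -> R -> R) t :
  (forall i, derivable (f i) t 1) -> derivable (fun s => \prod_(i <- r) f i s) t 1.
Proof.
move=> df; elim: r => [|i r IH].
  rewrite (_ : (fun s => _) = cst (1 : R)); first exact: derivable_cst.
  by apply/funext => s; rewrite big_nil.
rewrite (_ : (fun s => _) = f i * fun s => \prod_(j <- r) f j s).
  exact: (@derivableM _ _ (f i) _ t 1 (df i) IH).
by apply/funext => s; rewrite big_cons.
Qed.

Lemma derivable_det n (X : R -> 'M[R]_n) t :
  (forall i j, derivable (fun s => X s i j) t 1) ->
  derivable (fun s => \det (X s)) t 1.
Proof.
move=> dX; apply: derivable_bigsum => s.
apply: derivableM; first exact: derivable_cst.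
exact: derivable_bigprod.
Qed.

(** Cramer's formula shows that the inverse is differentiable; the value of the derivative then
    follows by differentiating X X^-1 = 1. *)
Lemma mxder_invmx n (X : R -> 'M[R]_n) t X' : mxder X t X' -> X t \in unitmx ->
  mxder (fun s => invmx (X s)) t (- (invmx (X t) *m X' *m invmx (X t))).
Proof.
move=> dX uX; pose Y s := (\det (X s))^-1 *: \adj (X s).
have dX1 i j : derivable (fun s => X s i j) t 1 by case: (dX i j).
have ddet := derivable_det dX1.
have det0 : \det (X t) != 0 by rewrite -unitfE.
have unear : \near t, X t \in unitmx.
  have cdet : {for t, continuous (fun s => \det (X s))}.
    exact/differentiable_continuous/derivable1_diffP.
  near=> s; rewrite unitmxE unitfE; near: s.
  exact: (@cvgr_neq0 _ _ _ _ _ _ _ cdet det0).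
have dY i j : derivable (fun s => Y s i j) t 1.
  rewrite /Y; under eq_fun do rewrite !mxE.
  apply: derivableM; first exact: derivableV.
  apply: derivableM; first exact: derivable_cst.
  apply: derivable_det => k l; under eq_fun do rewrite !mxE.
  exact: dX1.
have YE : \near t, Y t = invmx (X t).
  by apply: filterS unear => s us; rewrite /invmx us.
pose Y' : 'M[R]_n := \matrix_(i, j) 'D_1 (fun s => Y s i j) t.
have dY' : mxder (fun s => invmx (X s)) t Y'.
  by apply: (mxder_near YE) => i j; rewrite mxE; exact: (derivableP (dY i j)).
apply: mxder_eq (dY') _.
have d1 : mxder (fun s => X s *m invmx (X s)) t 0.
  apply: mxder_near (mxder_cst 1%:M t).
  by apply: filterS unear => s us; rewrite mulmxV.
have : X' *m invmx (X t) + X t *m Y' = 0.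
  apply/matrixP => i j.
  have [_ <-] := d1 i j; have [_ <-] := mxderM dX dY' i j.
  by [].
move=> /eqP; rewrite addrC addr_eq0 => /eqP /(congr1 (mulmx (invmx (X t)))).
by rewrite mulKmx// => ->; rewrite mulmxN mulmxA.
Unshelve. all: by end_near. Qed.

End matrix_derivative.

(** * Continuity and primitives *)

Section within_continuity.
Context {R : realType}.
Implicit Types (m n p : nat) (t : R).

Lemma within_continuous_ext (f g : R -> R) t0 : f =1 g ->
  {within `[t0, +oo[, continuous f} -> {within `[t0, +oo[, continuous g}.
Proof. by move=> /funext ->. Qed.

Lemma mxcont_cst m n (A : 'M[R]_(m, n)) t0 : mxcont t0 (fun=> A).
Proof. by move=> i j x; exact: cst_continuous. Qed.

Lemma mxcontD m n (X Y : R -> 'M[R]_(m, n)) t0 :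
  mxcont t0 X -> mxcont t0 Y -> mxcont t0 (fun s => X s + Y s).
Proof.
move=> cX cY i j; apply: (@within_continuous_ext (fun s => X s i j + Y s i j)) => [s|];
  first by rewrite mxE.
by move=> x; apply: (@continuousD _ _ (subspace `[t0, +oo[)); [exact: cX|exact: cY].
Qed.

Lemma mxcontN m n (X : R -> 'M[R]_(m, n)) t0 :
  mxcont t0 X -> mxcont t0 (fun s => - X s).
Proof.
move=> cX i j; apply: (@within_continuous_ext (fun s => - X s i j)) => [s|];
  first by rewrite mxE.
by move=> x; apply: (@continuousN _ _ (subspace `[t0, +oo[)); exact: cX.
Qed.

Lemma within_continuousM (f g : R -> R) t0 :
  {within `[t0, +oo[, continuous f} -> {within `[t0, +oo[, continuous g} ->
  {within `[t0, +oo[, continuous (fun s => f s * g s)}.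
Proof.
by move=> cf cg x; apply: (@continuousM _ (subspace `[t0, +oo[)); [exact: cf|exact: cg].
Qed.

Lemma within_continuous_sum n (f : 'I_n -> R -> R) t0 :
  (forall i, {within `[t0, +oo[, continuous (f i)}) ->
  {within `[t0, +oo[, continuous (fun s => \sum_i f i s)}.
Proof.
elim: n f => [|n IH] f cf.
  apply: (@within_continuous_ext (fun=> 0)) => [s|]; first by rewrite big_ord0.
  by move=> x; exact: cst_continuous.
apply: (@within_continuous_ext (fun s => f ord0 s + \sum_i f (lift ord0 i) s)).
  by move=> s; rewrite big_ord_recl.
move=> x; apply: (@continuousD _ _ (subspace `[t0, +oo[)); first exact: cf.
by apply: IH => i; exact: cf.
Qed.

Lemma mxcontM m n p (X : R -> 'M[R]_(m, n)) (Y : R -> 'M[R]_(n, p)) t0 :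
  mxcont t0 X -> mxcont t0 Y -> mxcont t0 (fun s => X s *m Y s).
Proof.
move=> cX cY i j; apply: (@within_continuous_ext (fun s => \sum_k X s i k * Y s k j)) => [s|];
  first by rewrite mxE.
by apply: within_continuous_sum => k; exact: within_continuousM.
Qed.

Lemma mxcont_tr m n (X : R -> 'M[R]_(m, n)) t0 :
  mxcont t0 X -> mxcont t0 (fun s => (X s)^T).
Proof.
move=> cX i j; apply: (@within_continuous_ext (fun s => X s j i)) => [s|];
  first by rewrite mxE.
exact: cX.
Qed.

Lemma mxcontZ m n (f : R -> R) (X : R -> 'M[R]_(m, n)) t0 :
  {within `[t0, +oo[, continuous f} ->
  mxcont t0 X -> mxcont t0 (fun s => f s *: X s).
Proof.
move=> cf cX i j; apply: (@within_continuous_ext (fun s => f s * X s i j)) => [s|];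
  first by rewrite mxE.
exact: within_continuousM.
Qed.

Lemma mxcont_col m1 m2 n (X : R -> 'M[R]_(m1, n)) (Y : R -> 'M[R]_(m2, n)) t0 :
  mxcont t0 X -> mxcont t0 Y -> mxcont t0 (fun s => col_mx (X s) (Y s)).
Proof.
move=> cX cY i j; case: (splitP i) => k ik.
  have -> : i = lshift m2 k by exact: val_inj.
  by apply: (@within_continuous_ext (fun s => X s k j)) => [s|]; [rewrite col_mxEu|exact: cX].
have -> : i = rshift m1 k by exact: val_inj.
by apply: (@within_continuous_ext (fun s => Y s k j)) => [s|]; [rewrite col_mxEd|exact: cY].
Qed.

Lemma mxcontB_col m1 m2 n (X X' : R -> 'M[R]_(m1, n)) (Y Y' : R -> 'M[R]_(m2, n)) t0 :
  mxcont t0 (fun s => col_mx (X s) (Y s)) -> mxcont t0 X' -> mxcont t0 Y' ->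
  mxcont t0 (fun s => col_mx (X s - X' s) (Y s - Y' s)).
Proof.
move=> cXY cX' cY'; rewrite (_ : (fun s => _) =
    fun s => col_mx (X s) (Y s) - col_mx (X' s) (Y' s)).
  by apply: mxcontD => //; apply: mxcontN; exact: mxcont_col.
by apply/funext => s; rewrite opp_col_mx add_col_mx.
Qed.

Lemma within_dot n (x y : R -> 'cV[R]_n) t0 : mxcont t0 x -> mxcont t0 y ->
  {within `[t0, +oo[, continuous (fun s => dot (x s) (y s))}.
Proof.
move=> cx cy; apply: (@within_continuous_ext (fun s => \sum_i x s i 0 * y s i 0)).
  by move=> s; rewrite dotE.
apply: within_continuous_sum => i.
by apply: within_continuousM; [exact: cx|exact: cy].
Qed.

Lemma mxcont_bearing n (x : R -> 'cV[R]_n) t0 : mxcont t0 x ->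
  (forall t, t0 <= t -> x t != 0) -> mxcont t0 (fun t => bearing (x t)).
Proof.
move=> cx x0; apply: mxcontZ => //.
have enormE t : enorm (x t) = Num.sqrt (dot (x t) (x t)).
  by rewrite -enorm_sqr sqrtr_sqr ger0_norm// enorm_ge0.
apply: (@within_continuous_ext (fun s => (Num.sqrt (dot (x s) (x s)))^-1)).
  by move=> s; rewrite enormE.
apply/subspace_continuousP => t tt0; apply: cvgV.
  by rewrite gt_eqF// sqrtr_gt0 dot_gt0 x0//; move: tt0; rewrite /= in_itv/= andbT.
apply: (@cvg_comp _ _ _ (fun s => dot (x s) (x s)) Num.sqrt _ (nbhs (dot (x t) (x t)))).
  by move/subspace_continuousP : (within_dot cx cx) => /(_ t tt0).
exact: sqrt_continuous.
Qed.

(** Turns the integrals of the excitation conditions into increments, so that they can be compared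
    through derivatives. The bounds of integration are positive because [f] is only continuous from
    the right at 0. *)
Lemma primitive_exists (f : R -> R) : {within `[0, +oo[, continuous f} ->
  exists F : R -> R, (forall t, 0 < t -> is_derive t 1 F (f t)) /\
    forall a b, 0 < a -> a < b ->
      \int[lebesgue_measure]_(s in `[a, b]) f s = F b - F a.
Proof.
move=> cf; pose F t : R := \int[lebesgue_measure]_(s in `[0, t]) f s.
have cft t : 0 < t -> {for t, continuous f}.
  by move=> t0; apply: ((continuous_within_itvcyP _ _).1 cf).1;
    rewrite in_itv/= andbT.
have cfab a b : 0 <= a -> {within `[a, b], continuous f}.
  move=> a0; apply: continuous_subspaceW cf => s /=.
  by rewrite !in_itv/= andbT => /andP[? _]; exact: le_trans a0 _.
have dF t : 0 < t -> is_derive t 1 F (f t).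
  move=> t0; have tt1 : t < t + 1 by rewrite ltrDl.
  have fi : lebesgue_measure.-integrable `[0, t + 1] (EFin \o f).
    by apply: continuous_compact_integrable; [exact: segment_compact|exact: cfab].
  have [d1 d2] := continuous_FTC1_closed tt1 fi t0 (cft t t0).
  by constructor; [exact: d1|rewrite -derive1E].
exists F; split=> // a b a0 ab.
have := @continuous_FTC2 R f F a b ab (cfab a b (ltW a0)).
rewrite /Rintegral => -> //.
- split.
  + move=> s; rewrite in_itv/= => /andP[sa _].
    by have [] := dF s (lt_trans a0 sa).
  + apply/cvg_at_right_filter; exact: der_continuous (dF _ a0).
  + apply/cvg_at_left_filter; exact: der_continuous (dF _ (lt_trans a0 ab)).
- move=> s; rewrite in_itv/= => /andP[sa _].
  by rewrite derive1E; have [_ ->] := dF s (lt_trans a0 sa).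
Qed.

Lemma mx_primitive_exists m n (X : R -> 'M[R]_(m, n)) : mxcont 0 X ->
  exists F : R -> 'M[R]_(m, n), (forall t, 0 < t -> mxder F t (X t)) /\
    forall a b, 0 < a -> a < b -> intmx X a b = F b - F a.
Proof.
move=> cX; have /choice [F FE] : forall ij : 'I_m * 'I_n, exists F : R -> R,
    (forall t, 0 < t -> is_derive t 1 F (X t ij.1 ij.2)) /\
    forall a b, 0 < a -> a < b ->
      \int[lebesgue_measure]_(s in `[a, b]) X s ij.1 ij.2 = F b - F a.
  by move=> [i j]; exact: primitive_exists.
exists (fun t => \matrix_(i, j) F (i, j) t); split=> [t t0 i j|a b a0 ab].
  by under eq_fun do rewrite mxE; exact: (FE (i, j)).1.
by apply/matrixP => i j; rewrite !mxE (FE (i, j)).2.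
Qed.

End within_continuity.

(** * Projections orthogonal to a unit vector *)

Section orth_proj.
Context {R : realType} {d : nat}.
Implicit Types y x : 'cV[R]_d.

Lemma dot_bearing x : x != 0 -> dot (bearing x) (bearing x) = 1.
Proof.
move=> x0; have : dot x x != 0 by rewrite dot_eq0.
rewrite dotZr dotZl -enorm_sqr mulrA -invfM -expr2 => h.
by rewrite mulVf.
Qed.

Lemma orth_proj_tr y : (orth_proj y)^T = orth_proj y.
Proof. by rewrite /orth_proj linearB/= trmx1 trmx_mul trmxK. Qed.

Lemma orth_projE y x : orth_proj y *m x = x - dot y x *: y.
Proof.
rewrite /orth_proj mulmxBl mul1mx -mulmxA [y^T *m x]mx11_scalar.
by rewrite mul_mx_scalar.
Qed.

Lemma orth_proj_idem y x : dot y y = 1 ->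
  orth_proj y *m (orth_proj y *m x) = orth_proj y *m x.
Proof.
move=> y1; rewrite [LHS]orth_projE orth_projE dotBr dotZr y1 mulr1 subrr.
by rewrite scale0r subr0.
Qed.

Lemma dot_orth_proj y x : dot y y = 1 ->
  dot (orth_proj y *m x) (orth_proj y *m x) = dot x (orth_proj y *m x).
Proof.
by move=> y1; rewrite -[in RHS](orth_proj_idem x y1) [RHS]dot_mulmxr orth_proj_tr.
Qed.

Lemma orth_proj_le y x : dot y y = 1 ->
  dot (orth_proj y *m x) (orth_proj y *m x) <= dot x x.
Proof.
move=> y1; rewrite dot_orth_proj// orth_projE dotBr dotZr (dotC x y).
by rewrite gerBl -expr2 sqr_ge0.
Qed.

Lemma orth_proj_bearing x : orth_proj (bearing x) *m x = 0.
Proof.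
have [->|x0] := eqVneq x 0; first by rewrite mulmx0.
rewrite orth_projE dotZl scalerA.
have e0 : enorm x != 0 by rewrite -sqrf_eq0 enorm_sqr dot_eq0.
rewrite -enorm_sqr (_ : _ * _ = 1) ?scale1r ?subrr//.
by field.
Qed.

(** The columns are projections of basis vectors, hence of norm at most 1. *)
Lemma mxsq_orth_proj y : dot y y = 1 -> mxsq (orth_proj y) <= d%:R.
Proof.
move=> y1; have -> : mxsq (orth_proj y) = \sum_j dot (orth_proj y *m delta_mx j 0)
    (orth_proj y *m delta_mx j 0).
  rewrite /mxsq exchange_big; apply: eq_bigr => j _; rewrite dotE.
  by apply: eq_bigr => i _; rewrite -colE !mxE expr2.
rewrite -[X in X%:R]card_ord -sumr_const; apply: ler_sum => j _.
apply: le_trans (orth_proj_le _ y1) _.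
rewrite dotE (bigD1 j)//= big1 ?mxE ?eqxx ?mulr1 ?addr0// => i ij.
by rewrite mxE (negbTE ij) mul0r.
Qed.

End orth_proj.

(** * Observability from persistent excitation *)

Section observability.
Context {R : realType} {d : nat}.
Implicit Types (g : R -> 'cV[R]_d) (t : R).

Lemma integrator_A_col (a b : 'cV[R]_d) :
  integrator_A R d *m col_mx a b = col_mx b 0.
Proof. by rewrite mul_block_col !mul0mx mul1mx add0r addr0. Qed.

(** This makes the flow of the double integrator affine in time, namely [1%:M + h *: A]. *)
Lemma integrator_A_sq : integrator_A R d *m integrator_A R d = 0.
Proof.
rewrite mulmx_block !mul0mx !mulmx0 !addr0; apply/matrixP => i j.
by rewrite !mxE; case: (fintype.split i) => ?;
  rewrite !mxE; case: (fintype.split j) => ?;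
  rewrite mxE.
Qed.

Lemma PE_ge g : PE g -> exists T mu : R, [/\ 0 < T, 0 < mu &
  forall t, 0 <= t -> forall x,
    mu * T * dot x x <=
      dot x (intmx (fun s => orth_proj (g s)) t (t + T) *m x)].
Proof.
move=> [T [mu [T0 mu0 h]]]; exists T, mu; split=> // t t0 x.
have [_ /(_ x)] := h t t0.
rewrite quadE mulmxBl mul_scalar_mx -scalemxAl dotBr !dotZr subr_ge0.
by rewrite ler_pdivlMl// mulrCA mulrA.
Qed.

(* Where g turns fast the bearing may keep pointing along the moving vector
   a + h b over a whole window; over two distant windows it cannot, because
   the vector changes by far more between them than within either of them. *)
Lemma PE_observable g : (forall t, 0 <= t -> dot (g t) (g t) = 1) ->
  mxcont 0 g -> PE g ->
  exists T c : R, [/\ 0 < T, 0 < c & forall t (Y : R -> 'M[R]_(d + d)), T < t ->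
    (forall s, t - T <= s <= t -> mxder Y s
      ((output_C (g s) *m (1%:M + (s - t) *: integrator_A R d))^T *m
       (output_C (g s) *m (1%:M + (s - t) *: integrator_A R d)))) ->
    forall x, c * dot x x <= dot x ((Y t - Y (t - T)) *m x)].
Proof.
move=> g1 cg /PE_ge[T [mu [T0 mu0 PEg]]].
have [F [dF FE]] : exists F : R -> 'M[R]_d,
    (forall t, 0 < t -> mxder F t (orth_proj (g t))) /\
    forall a b, 0 < a -> a < b -> intmx (fun s => orth_proj (g s)) a b = F b - F a.
  apply: mx_primitive_exists; apply: mxcontD; first exact: mxcont_cst.
  by apply: mxcontN; apply: mxcontM => //; exact: mxcont_tr.
(* The distance between the two windows. It is large enough for tau^2 >= 16 T^2 / mu, so that the
   total freezing error 2 T^3 |b|^2 takes at most half of what PE provides. *)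
pose tau := T * (1 + 16 / mu).
have Ttau : T <= tau.
  apply: ler_peMr; first exact: ltW.
  by rewrite lerDl divr_ge0// ltW.
have tau0 : 0 < tau by exact: lt_le_trans Ttau.
have tau2 : 16 * T ^+ 2 / mu <= tau ^+ 2.
  rewrite /tau exprMn [leLHS](_ : _ = T ^+ 2 * (16 / mu)); last by ring.
  rewrite ler_pM2l ?exprn_gt0//; set u := 16 / mu.
  have : 0 <= u by rewrite divr_ge0// ltW.
  by move=> u0; have := sqr_ge0 u; rewrite !expr2; lra.
(* The numerator is what PE leaves, per unit of [Z], after that error; the denominator comes from
   |a|^2 + |b|^2 <= (6 + 2 / tau^2) Z. *)
pose c := 4^-1 * mu * T / (6 + 2 / tau ^+ 2).
have den0 : 0 < 6 + 2 / tau ^+ 2 by rewrite addr_gt0// divr_gt0// exprn_gt0.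
exists (tau + T), c; split; first by rewrite addr_gt0.
  by rewrite divr_gt0// !mulr_gt0.
move=> t Y tT dY x; rewrite -[x]vsubmxK.
move: (usubmx x) (dsubmx x) => a b {x}; set x := col_mx a b.
(* Position component of the flow that passes through [x] at time [t]. *)
pose z s := a + (s - t) *: b.
have outE s : output_C (g s) *m (1%:M + (s - t) *: integrator_A R d) *m x =
    orth_proj (g s) *m z s.
  rewrite /output_C -!mulmxA mulmxDl mul1mx -scalemxAl integrator_A_col.
  by rewrite scale_col_mx add_col_mx mul_row_col mul1mx mul0mx addr0.
have dYx s : t - (tau + T) <= s <= t ->
    is_derive s 1 (fun s => dot x (Y s *m x))
      (dot (orth_proj (g s) *m z s) (orth_proj (g s) *m z s)).
  move=> /dY dYs; apply: der_eq (der_quad_cst x dYs) _.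
  by rewrite -mulmxA dot_mulmxr trmxK outE.
have spos s : t - (tau + T) <= s -> 0 < s.
  by move=> h; apply: lt_le_trans h; rewrite subr_gt0.
(* PE speaks of a fixed vector, so [z s] is frozen at its value at [w]. Since it moves by at most T
   |b| in the window, this keeps half of the PE bound and costs at most T^3 |b|^2. *)
have win w : t - (tau + T) <= w -> w + T <= t ->
    2^-1 * (mu * T) * dot (z w) (z w) - T ^+ 3 * dot b b <=
    dot x (Y (w + T) *m x) - dot x (Y w *m x).
  move=> w1 w2; have w0 := spos _ w1.
  have PEw := PEg w (ltW w0) (z w).
  rewrite FE ?ltrDl// mulmxBl dotBr in PEw.
  have h := @der_lb _ (fun s => dot x (Y s *m x) + - (2^-1 * dot (z w) (F s *m z w)))
    (fun s => dot (orth_proj (g s) *m z s) (orth_proj (g s) *m z s) +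
      - (2^-1 * dot (z w) (orth_proj (g s) *m z w))) (- (T ^+ 2 * dot b b)) w (w + T).
  have {h} h : - (T ^+ 2 * dot b b) * (w + T - w) <=
     dot x (Y (w + T) *m x) + - (2^-1 * dot (z w) (F (w + T) *m z w)) -
     (dot x (Y w *m x) + - (2^-1 * dot (z w) (F w *m z w))).
    apply: h => [|s /andP[ws sw]|s /andP[ws sw]]; first by rewrite lerDl ltW.
      apply: derD; first by apply: dYx; rewrite (le_trans w1)// (le_trans sw).
      by apply/derN/derZ/der_quad_cst/dF/(lt_le_trans w0).
    have s0 : 0 <= s by rewrite (le_trans (ltW w0)).
    have zE : z s = z w + (s - w) *: b.
      by rewrite /z -addrA -scalerDl; congr (_ + _ *: _); ring.
    rewrite -dot_orth_proj ?g1// zE mulmxDr.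
    have h1 := dotD_ge (orth_proj (g s) *m z w) (orth_proj (g s) *m ((s - w) *: b)).
    have h2 := orth_proj_le ((s - w) *: b) (g1 s s0).
    have h3 : dot ((s - w) *: b) ((s - w) *: b) <= T ^+ 2 * dot b b.
      rewrite dotZl dotZr mulrA -expr2 ler_wpM2r ?dot_ge0// lerXn2r ?nnegrE ?subr_ge0//.
        exact: ltW.
      by rewrite lerBlDl.
    lra.
  move: h; rewrite [w + T - w](_ : _ = T); last by ring.
  rewrite mulNr [T ^+ 2 * dot b b * T](_ : _ = T ^+ 3 * dot b b); last by ring.
  move: PEw; lra.
have mono w v : t - (tau + T) <= w -> w <= v -> v <= t ->
    dot x (Y w *m x) <= dot x (Y v *m x).
  move=> w1 wv vt; rewrite -subr_ge0.
  have := @der_lb _ (fun s => dot x (Y s *m x))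
    (fun s => dot (orth_proj (g s) *m z s) (orth_proj (g s) *m z s)) 0 w v wv.
  rewrite mul0r; apply=> s /andP[ws sv]; last exact: dot_ge0.
  by apply: dYx; rewrite (le_trans w1)// (le_trans sv).
(* The windows start [tau] apart, so [z] changes by exactly [tau *: b] from one to the other; this
   bounds [b] by the values of [z] there. *)
pose w1 := t - (tau + T); pose w2 := t - T.
have h1 : 2^-1 * (mu * T) * dot (z w1) (z w1) - T ^+ 3 * dot b b <=
    dot x (Y (w1 + T) *m x) - dot x (Y w1 *m x).
  by apply: win => //; rewrite /w1; lra.
have h2 : 2^-1 * (mu * T) * dot (z w2) (z w2) - T ^+ 3 * dot b b <=
    dot x (Y t *m x) - dot x (Y w2 *m x).
  have := win w2; rewrite {3}/w2 subrK; apply; rewrite /w2 ?subrK//; lra.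
have h3 : dot x (Y (w1 + T) *m x) <= dot x (Y w2 *m x).
  by apply: mono; rewrite /w1 /w2; lra.
set Z := dot (z w1) (z w1) + dot (z w2) (z w2).
have hb : tau ^+ 2 * dot b b <= 2 * Z.
  have : tau *: b = z w2 + - z w1.
    by rewrite /z opprD addrACA subrr add0r -scalerBl; congr (_ *: _);
      rewrite /w1 /w2; ring.
  move=> /(congr1 (fun v => dot v v)); rewrite dotZl dotZr mulrA -expr2 => ->.
  by have := dotD_le (z w2) (- z w1);
    rewrite [dot (- z w1) _]dotNl dotNr opprK /Z; lra.
have ha : dot a a <= 2 * dot (z w2) (z w2) + 2 * (T ^+ 2 * dot b b).
  have -> : a = z w2 + T *: b.
    by rewrite /z -addrA -scalerDl /w2 [t - T - t + T](_ : _ = 0) ?scale0r ?addr0//; ring.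
  by have := dotD_le (z w2) (T *: b); rewrite [dot (T *: b) _]dotZl dotZr; lra.
have hT : T ^+ 2 * dot b b <= tau ^+ 2 * dot b b.
  by rewrite ler_wpM2r ?dot_ge0// lerXn2r ?nnegrE// ltW.
have hZ : dot (z w2) (z w2) <= Z by rewrite lerDr dot_ge0.
have hx : dot x x <= (6 + 2 / tau ^+ 2) * Z.
  have -> : dot x x = dot a a + dot b b by rewrite dot_col_mx.
  have hb' : dot b b <= 2 / tau ^+ 2 * Z.
    by rewrite mulrAC ler_pdivlMr ?exprn_gt0// mulrC.
  rewrite mulrDl; apply: lerD => //; lra.
have hTb : 2 * (T ^+ 3 * dot b b) <= 4^-1 * (mu * T) * Z.
  have := ler_wpM2r (dot_ge0 b) tau2 => h4.
  have h5 : 16 * T ^+ 2 / mu * dot b b <= 2 * Z by exact: le_trans hb.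
  have h6 := ler_wpM2l (ltW (mulr_gt0 mu0 T0)) h5.
  have E : mu * T * (16 * T ^+ 2 / mu * dot b b) = 16 * (T ^+ 3 * dot b b).
    by field; rewrite gt_eqF.
  rewrite E in h6; lra.
rewrite mulmxBl dotBr.
have hc : c * dot x x <= 4^-1 * (mu * T) * Z.
  have c0 : 0 <= c by rewrite divr_ge0 ?ltW// !mulr_gt0.
  apply: le_trans (ler_wpM2l c0 hx) _.
  by rewrite mulrA /c divfK ?gt_eqF// !mulrA.
rewrite -/w1; move: h1 h2 h3 hTb hc; rewrite /Z; lra.
Qed.

End observability.

(** * The Riccati equation *)

Section one_sided.
Context {R : realType}.
Implicit Types (f : R -> R) (a t e : R).

Lemma right_continuous_lt f a e : {within `[a, +oo[, continuous f} -> f a < e ->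
  exists2 dl, 0 < dl & forall s, a <= s <= a + dl -> f s < e.
Proof.
move=> /continuous_within_itvcyP[_ cf] fe.
have [dl /= dl0 H] := cvgr_lt _ cf _ fe.
exists (dl / 2) => [|s /andP[]]; first by rewrite divr_gt0.
rewrite le_eqVlt => /predU1P[<- //|as_ sdl]; apply: H => //=.
rewrite ltr_distlC; apply/andP; split; lra.
Qed.

Lemma left_limit_ge f a t B : a < t -> {for t, continuous f} ->
  (forall s, a < s < t -> B <= f s) -> B <= f t.
Proof.
move=> at_ cf Bf; apply: (cvgr_to_ge (cvg_at_left_filter cf)).
near=> s; apply: Bf; apply/andP; split => //.
Unshelve. all: by end_near. Qed.

Lemma der_left_min_le0 f a t b : a < t -> is_derive t 1 f b ->
  (forall s, a < s < t -> f t <= f s) -> b <= 0.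
Proof.
move=> at_ [df <-] ft.
have := cvg_dnbhs_at_left df => h.
apply: (cvgr_to_le h); near=> s.
have s0 : s < 0 by [].
rewrite /= -[_ *: (1 : R)]/(_ * 1) mulr1 nmulr_rle0 ?invr_lt0// subr_ge0.
apply: ft; rewrite gtrDr s0 andbT.
rewrite -ltrBlDr; near: s; apply: nbhs_left_gt; lra.
Unshelve. all: by end_near. Qed.

End one_sided.

Section mxsq_analysis.
Context {R : realType}.
Implicit Types (m n : nat).

Lemma mxsq_eq0 m n (X : 'M[R]_(m, n)) : mxsq X = 0 -> X = 0.
Proof.
move=> X0; apply/matrixP => i j; rewrite [RHS]mxE; apply/eqP.
rewrite -sqrf_eq0 eq_le sqr_ge0 andbT -X0 /mxsq (bigD1 i)//= (bigD1 j)//=.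
by rewrite -addrA lerDl addr_ge0//; do ?[apply: sumr_ge0 => ? _]; exact: sqr_ge0.
Qed.

Lemma within_mxsq m n (X : R -> 'M[R]_(m, n)) t0 : mxcont t0 X ->
  {within `[t0, +oo[, continuous (fun s => mxsq (X s))}.
Proof.
move=> cX; apply: within_continuous_sum => i; apply: within_continuous_sum => j.
by apply: within_continuousM; exact: cX.
Qed.

Lemma mxcont_bounded m n (X : R -> 'M[R]_(m, n)) a b : mxcont a X -> a <= b ->
  exists B, forall s, a <= s <= b -> mxsq (X s) <= B.
Proof.
move=> cX ab; have [B HB] := within_bounded ab (within_mxsq cX).
by exists B => s /HB; apply: le_trans; exact: ler_norm.
Qed.

Lemma mxcontW m n (X : R -> 'M[R]_(m, n)) a b : a <= b -> mxcont a X -> mxcont b X.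
Proof.
move=> ab cX i j; apply: continuous_subspaceW (cX i j) => s /=.
by rewrite !in_itv/= !andbT; exact: le_trans.
Qed.

Lemma der_mxsq m n (X : R -> 'M[R]_(m, n)) t X' : mxder X t X' ->
  exists2 b, is_derive t 1 (fun s => mxsq (X s)) b & b <= mxsq (X t) + mxsq X'.
Proof.
move=> dX; exists (\sum_i \sum_j (X' i j * X t i j + X t i j * X' i j)).
  by apply: der_sum => i; apply: der_sum => j; exact: derM.
rewrite /mxsq -big_split; apply: ler_sum => i _ /=.
rewrite -big_split; apply: ler_sum => j _ /=.
by have := sqr_ge0 (X t i j - X' i j); rewrite !expr2; lra.
Qed.

Lemma quad_small n (E : 'M[R]_n) (c : R) (x : 'cV[R]_n) : 0 < c ->
  mxsq E <= c ^+ 2 -> - (c * dot x x) <= dot x (E *m x).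
Proof.
move=> c0 Ec; have h := dot_youngN x (E *m x) c0.
have h2 : dot (E *m x) (E *m x) <= c ^+ 2 * dot x x.
  by apply: le_trans (dot_mulmx_le _ _) _; rewrite ler_wpM2r ?dot_ge0.
have h3 : c^-1 * dot (E *m x) (E *m x) <= c * dot x x.
  by rewrite ler_pdivrMl// mulrA -expr2.
lra.
Qed.

(** Used at [x = invmx X *m y], it turns an upper bound on the form of [X] into a lower bound on
    that of its inverse. *)
Lemma psd_mul_le_bound n (X : 'M[R]_n) (K : R) (x : 'cV[R]_n) : psdmx X ->
  (forall y, dot y (X *m y) <= K * dot y y) ->
  dot (X *m x) (X *m x) <= K * dot x (X *m x).
Proof.
move=> pX XK; have [->|x0] := eqVneq (X *m x) 0; first by rewrite !dot0r mulr0.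
have x1 : 0 < dot (X *m x) (X *m x) by rewrite dot_gt0.
have h1 := psd_cauchy_schwarz (X *m x) x pX.
have h3 : 0 <= dot x (X *m x) by rewrite -quadE; exact: pX.2.
rewrite -(ler_pM2l x1) -expr2; apply: le_trans h1 _.
by rewrite mulrCA mulrA ler_wpM2r.
Qed.

End mxsq_analysis.

(** For symmetric [G] and [S] the asymmetry M - M^T obeys a homogeneous linear equation, even before
    [M] is known to be symmetric; hence it stays zero if it starts at zero. *)
Lemma riccati_asym (R : realType) (N : nat) (A M G S : 'M[R]_N) :
  G^T = G -> S^T = S ->
  A *m M + M *m A^T - M *m G *m M + S - (A *m M + M *m A^T - M *m G *m M + S)^T =
  (A - M *m G) *m (M - M^T) + (M - M^T) *m (A - M *m G)^T.
Proof.
move=> trG trS.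
have -> : (A *m M + M *m A^T - M *m G *m M + S)^T =
    M^T *m A^T + A *m M^T - M^T *m G *m M^T + S.
  by rewrite !raddfD !raddfN /= !trmx_mul trmxK trG trS mulmxA.
have -> : (A - M *m G)^T = A^T - G *m M^T.
  by rewrite raddfD raddfN /= trmx_mul trG.
rewrite mulmxBl !mulmxBr !mulmxBl !mulmxA.
by apply/matrixP => i j; rewrite !mxE; ring.
Qed.

Section riccati.
Context {R : realType} {N q : nat}.
Variables (A S : 'M[R]_N) (Q : 'M[R]_q) (C : R -> 'M[R]_(q, N)) (M : R -> 'M[R]_N).
Variable Kc : R.
Hypothesis pdM0 : pdmx (M 0).
Hypothesis pdQ : pdmx Q.
Hypothesis pdS : pdmx S.
Hypothesis C_le : forall t : R, 0 <= t -> mxsq (C t) <= Kc.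
Hypothesis M_cont : mxcont 0 M.

Let M' t := A *m M t + M t *m A^T - M t *m (C t)^T *m Q *m C t *m M t + S.
Hypothesis M_der : forall t : R, 0 < t -> mxder M t (M' t).

Let Kc_ge0 : 0 <= Kc.
Proof. by apply: le_trans (C_le (lexx 0)); exact: mxsq_ge0. Qed.

Let C_dot_le (t : R) x : 0 <= t -> dot (C t *m x) (C t *m x) <= Kc * dot x x.
Proof.
move=> t0; apply: le_trans (dot_mulmx_le _ _) _.
by rewrite ler_wpM2r ?dot_ge0 ?C_le.
Qed.

(* M and its transpose solve the same equation with the same initial value. *)
Lemma riccati_sym (t : R) : 0 <= t -> (M t)^T = M t.
Proof.
rewrite le_eqVlt => /predU1P[<-|t0]; first exact: pdM0.1.
pose D s := M s - (M s)^T; pose X s := A - M s *m (C s)^T *m Q *m C s.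
have dD s : 0 < s -> mxder D s (X s *m D s + D s *m (X s)^T).
  move=> s0; apply: mxder_eq (mxderB (M_der s0) (mxder_tr (M_der s0))) _.
  have trG : ((C s)^T *m Q *m C s)^T = (C s)^T *m Q *m C s.
    by rewrite !trmx_mul trmxK pdQ.1 mulmxA.
  have MG : M s *m (C s)^T *m Q *m C s = M s *m ((C s)^T *m Q *m C s).
    by rewrite !mulmxA.
  rewrite /M' /X /D MG; move: (_ *m Q *m C s) trG => G trG.
  by rewrite riccati_asym// pdS.1.
have [B HB] : exists B, forall s, 0 < s <= t -> mxsq (X s) <= B.
  have [B HB] := mxcont_bounded M_cont (ltW t0).
  exists (2 * mxsq A + 2 * (B * (Kc * (mxsq Q * Kc)))) => s /andP[s0 st].
  apply: le_trans (mxsqD _ _) _; rewrite lerD2l.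
  rewrite -scaleN1r mxsqZ sqrrN expr1n mul1r ler_pM2l// -!mulmxA.
  have B1 : mxsq (M s) <= B by rewrite HB// (ltW s0).
  apply: le_trans (mxsq_mul _ _) _; apply: ler_pM => //; try exact: mxsq_ge0.
  apply: le_trans (mxsq_mul _ _) _; apply: ler_pM; try exact: mxsq_ge0.
    by rewrite mxsq_tr C_le// ltW.
  apply: le_trans (mxsq_mul _ _) _; apply: ler_pM; rewrite ?mxsq_ge0//.
  by rewrite C_le// ltW.
(* A growth rate for [mxsq (D s)], with some room: its derivative is at most |D|^2 + |D'|^2, and [B]
   bounds the coefficient of the linear equation. *)
pose k := 1 + 8 * B.
have B0 : 0 <= B by apply: le_trans (HB t _); rewrite ?mxsq_ge0 ?t0 ?lexx.
(* Growth is estimated from [t1 > 0], where derivatives exist, with a left side free of [t1]; then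
   [t1] tends to 0, where [D] vanishes. *)
have dec (t1 : R) : 0 < t1 < t -> expR (- (k * t)) * mxsq (D t) <= mxsq (D t1).
  move=> /andP[t10 t1t].
  have F : mxsq (D t) <= expR (- (- k * (t - t1))) * mxsq (D t1) ->
      expR (- (k * t)) * mxsq (D t) <= mxsq (D t1).
    move=> /(ler_wpM2l (expR_ge0 (- (k * t)))) /le_trans; apply.
    rewrite mulrA -expRD ler_piMl ?mxsq_ge0// -expR0 ler_expR.
    have -> : - (k * t) - - k * (t - t1) = - (k * t1) by ring.
    by rewrite oppr_le0 mulr_ge0 ?ltW// ltr_wpDr// mulr_ge0.
  apply: F; apply: (@exp_decay _ (fun s => mxsq (D s)) (- k)) => [|s /andP[s1 s2]];
    first exact: ltW.
  have s0 : 0 < s by exact: lt_le_trans s1.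
  have [b db bD] := der_mxsq (dD s s0); exists b => //.
  apply: le_trans bD _; rewrite opprK /k mulrDl mul1r lerD2l.
  apply: le_trans (mxsqD _ _) _.
  have HBs : mxsq (X s) <= B by rewrite HB// s0.
  have h1 : mxsq (X s *m D s) <= B * mxsq (D s).
    by apply: le_trans (mxsq_mul _ _) _; rewrite ler_wpM2r ?mxsq_ge0.
  have h2 : mxsq (D s *m (X s)^T) <= B * mxsq (D s).
    by apply: le_trans (mxsq_mul _ _) _; rewrite mulrC mxsq_tr ler_wpM2r ?mxsq_ge0.
  have := mulr_ge0 B0 (mxsq_ge0 (D s)); lra.
have D0 : expR (- (k * t)) * mxsq (D t) <= mxsq (D 0).
  apply: right_limit_le t0 _ dec; apply: within_mxsq.
  by apply: mxcontD => //; apply: mxcontN; exact: mxcont_tr.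
move: D0; rewrite {2}/D pdM0.1 subrr {2}/mxsq big1 => [|i _]; last first.
  by rewrite big1// => j _; rewrite mxE expr2 mul0r.
rewrite pmulr_rle0 ?expR_gt0// => D0.
suff D0' : D t = 0 by apply/esym/eqP; rewrite -subr_eq0 -/(D t) D0'.
by apply: mxsq_eq0; apply/le_anti; rewrite D0 mxsq_ge0.
Qed.


(* At the first time where M - m1 I becomes singular, a vector x of its kernel
   satisfies M x = m1 x, and the derivative of x^T M x is positive there. *)
Lemma riccati_lb : exists2 m1 : R, 0 < m1 &
  forall t x, 0 <= t -> m1 * dot x x <= dot x (M t *m x).
Proof.
have [m0 m00 Hm0] := pd_coercive pdM0.
have [sg sg0 HS] := pd_coercive pdS.
(* When M x = m1 x with m1 <= 1, the terms of x^T M' x other than x^T S x are at least - m1 k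
   |x|^2. *)
pose k := 2 * (1 + mxsq A) + (1 + mxsq Q) * Kc.
have k0 : 0 < k.
  have := mxsq_ge0 A; have : 0 <= (1 + mxsq Q) * Kc.
    by rewrite mulr_ge0// addr_ge0// mxsq_ge0.
  by rewrite /k => *; lra.
(* Below [m0], so that the bound is strict at time 0; at most 1, so that the quadratic term in m1 is
   dominated by m1; and so small that m1 k stays below the coercivity constant of [S]. *)
pose m1 := Num.min (m0 / 2) (Num.min 1 (sg / (2 * k))).
have m10 : 0 < m1 by rewrite !lt_min ltr01 !divr_gt0// mulr_gt0.
have m1m0 : m1 < m0.
  have : m1 <= m0 / 2 by rewrite ge_min lexx.
  by lra.
have m1_le1 : m1 <= 1 by rewrite !ge_min lexx !orbT.
have m1k : m1 * k < sg.
  have : m1 <= sg / (2 * k) by rewrite !ge_min lexx !orbT.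
  rewrite invfM mulrA ler_pdivlMr//; lra.
exists m1 => //.
pose P t := forall x, m1 * dot x x <= dot x (M t *m x).
suff PT t : 0 <= t -> P t by move=> t x t0; exact: PT.
move=> t0; apply: contrapT => nPt.
pose G := [set s : R | 0 <= s /\ forall r, 0 <= r <= s -> P r].
have P0 : P 0.
  move=> x; apply: le_trans (Hm0 x).
  by rewrite ler_wpM2r ?dot_ge0 ?ltW.
have G0 : G 0.
  split=> // r /andP[r0 r1]; have -> : r = 0 by apply/le_anti; rewrite r0 r1.
  exact: P0.
have Gt s : G s -> s < t.
  by move=> [s0 Gs]; rewrite ltNge; apply/negP => ts; apply: nPt; apply: Gs;
    rewrite t0.
have Gsup : has_sup G by split; [exists 0|exists t => s /Gt/ltW].
pose T := sup G.
have T0 : 0 <= T by exact: ub_le_sup (Gsup.2) _ G0.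
have PltT s : 0 <= s < T -> P s.
  move=> /andP[s0 sT]; have [e Ge se] := sup_adherent (eps := T - s) ltac:(by rewrite subr_gt0) Gsup.
  by apply: Ge.2; rewrite s0 ltW//; move: se; rewrite -/T; lra.
have PT : P T.
  move: T0; rewrite le_eqVlt => /predU1P[<- //|T0] x.
  apply: (@left_limit_ge _ (fun s => dot x (M s *m x)) 0 T) => //.
    exact: der_continuous (der_quad_cst x (M_der T0)).
  by move=> s /andP[s0 sT]; apply: PltT; rewrite ltW.
pose E := M T - m1%:M.
have EE x : dot x (E *m x) = dot x (M T *m x) - m1 * dot x x.
  by rewrite mulmxBl mul_scalar_mx dotBr dotZr.
have psdE : psdmx E.
  split; first by rewrite raddfB /= riccati_sym// tr_scalar_mx.
  by move=> x; rewrite quadE EE subr_ge0; exact: PT.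
(* If the gap [E] is still definite at [T], right continuity of [M] extends the bound past [T],
   against the choice of [T] as a supremum. *)
have [pdE|] := pselect (pdmx E).
  have [c c0 Hc] := pd_coercive pdE.
  have cMT : {within `[T, +oo[, continuous (fun s => mxsq (M s - M T))}.
    apply: within_mxsq; apply: mxcontD; last exact: mxcont_cst.
    exact: mxcontW M_cont.
  have MT0 : mxsq (M T - M T) < c ^+ 2.
    rewrite subrr /mxsq big1 ?exprn_gt0// => i _; rewrite big1// => j _.
    by rewrite mxE expr2 mul0r.
  have [dl dl0 Hdl] := right_continuous_lt cMT MT0.
  have : G (T + dl).
    split=> [|r /andP[r0 rT]]; first by rewrite addr_ge0// ltW.
    have [rT'|Tr] := ltP r T; first by apply: PltT; rewrite r0.
    move=> x; have h := Hdl r; rewrite Tr rT in h.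
    have := quad_small x c0 (ltW (h isT)); rewrite mulmxBl dotBr.
    by have := Hc x; rewrite EE; lra.
  move=> /(ub_le_sup Gsup.2); rewrite -/T; lra.
move=> npd; have [x x0 Ex] : exists2 x, x != 0 & dot x (E *m x) = 0.
  apply: contrapT => nx; apply: npd; split; first exact: psdE.1.
  move=> x x0; rewrite lt_def psdE.2 andbT; apply/eqP; rewrite quadE => h.
  by apply: nx; exists x.
have x1 : 0 < dot x x by rewrite dot_gt0.
have MTx : M T *m x = m1 *: x.
  have := psd_ker psdE Ex; rewrite mulmxBl mul_scalar_mx => /eqP.
  by rewrite subr_eq0 => /eqP.
have {}T0 : 0 < T.
  rewrite lt_def T0 andbT; apply/eqP => T00.
  have := Hm0 x; rewrite -T00 MTx dotZr ler_pM2r// leNgt m1m0//.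
have MTx' (u : 'cV[R]_N) : dot u (M T *m x) = m1 * dot u x by rewrite MTx dotZr.
have := @der_left_min_le0 _ (fun s => dot x (M s *m x)) 0 T _ T0
  (der_quad_cst x (M_der T0)).
(* Seen from the left, x^T M x is least at [T], so its derivative there is at most 0; but [S] makes
   it positive. *)
have -> : dot x (M' T *m x) <= 0 = false.
  apply/negbTE; rewrite -ltNge /M' !mulmxDl mulNmx !dotDr dotNr.
  have -> : dot x (A *m M T *m x) = m1 * dot x (A *m x).
    by rewrite -mulmxA MTx -scalemxAr dotZr.
  have -> : dot x (M T *m A^T *m x) = m1 * dot x (A *m x).
    by rewrite -mulmxA dot_mulmxr riccati_sym ?ltW// MTx dotZl dot_mulmxr trmxK dotC.
  have -> : dot x (M T *m (C T)^T *m Q *m C T *m M T *m x) =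
      m1 ^+ 2 * dot (C T *m x) (Q *m (C T *m x)).
    rewrite -!mulmxA MTx dot_mulmxr riccati_sym ?ltW// MTx dotZl dot_mulmxr trmxK.
    by rewrite -!scalemxAr dotZr mulrA expr2.
  have h1 := quad_le A x; have h2 := quad_le Q (C T *m x).
  have h3 := C_dot_le x (ltW T0); have h4 := HS x.
  have h5 : dot (C T *m x) (Q *m (C T *m x)) <= (1 + mxsq Q) * Kc * dot x x.
    apply: le_trans (ler_norm _) _; apply: le_trans h2 _.
    by rewrite -mulrA ler_wpM2l// addr_ge0// mxsq_ge0.
  have h6 : m1 ^+ 2 * dot (C T *m x) (Q *m (C T *m x)) <=
      m1 * ((1 + mxsq Q) * Kc * dot x x).
    apply: le_trans (ler_wpM2l (sqr_ge0 _) h5) _.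
    rewrite ler_wpM2r//; last by rewrite expr2 ler_piMl// ltW.
    by rewrite !mulr_ge0 ?dot_ge0// addr_ge0// mxsq_ge0.
  have h7 : - (m1 * ((1 + mxsq A) * dot x x)) <= m1 * dot x (A *m x).
    by rewrite -mulrN ler_pM2l//; move: h1; rewrite ler_norml => /andP[].
  have h8 : m1 * k * dot x x < sg * dot x x by rewrite ltr_pM2r.
  move: h8; rewrite /k; lra.
move=> h; suff: false by []; apply: h => s /andP[s0 sT]; rewrite MTx'.
by apply: PltT; rewrite ltW.
Qed.

End riccati.

(** * Upper bound on the Riccati solution *)

Section riccati_bounds.
Context {R : realType} {N q : nat}.
Variables (A S : 'M[R]_N) (Q : 'M[R]_q) (C : R -> 'M[R]_(q, N)) (M : R -> 'M[R]_N).
Variable Kc : R.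
Hypothesis pdM0 : pdmx (M 0).
Hypothesis pdQ : pdmx Q.
Hypothesis pdS : pdmx S.
Hypothesis C_le : forall t : R, 0 <= t -> mxsq (C t) <= Kc.
Hypothesis C_cont : mxcont 0 C.
Hypothesis M_cont : mxcont 0 M.

Let M' t := A *m M t + M t *m A^T - M t *m (C t)^T *m Q *m C t *m M t + S.
Hypothesis M_der : forall t : R, 0 < t -> mxder M t (M' t).

Hypothesis A_sq : A *m A = 0.
(** Uniform observability. The Gramian appears as the increment of an arbitrary primitive [Y] of its
    integrand, so that only derivatives have to be compared. *)
Hypothesis observable : exists T c : R, [/\ 0 < T, 0 < c &
  forall t (Y : R -> 'M[R]_N), T < t ->
    (forall s, t - T <= s <= t -> mxder Y s
      ((C s *m (1%:M + (s - t) *: A))^T *m (C s *m (1%:M + (s - t) *: A)))) ->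
    forall x, c * dot x x <= dot x ((Y t - Y (t - T)) *m x)].

Let M_sym (t : R) (t0 : 0 <= t) : (M t)^T = M t.
Proof. exact: (riccati_sym pdM0 pdQ pdS C_le M_cont M_der). Qed.

Let Kc_ge0 : 0 <= Kc.
Proof. by apply: le_trans (C_le (lexx 0)); exact: mxsq_ge0. Qed.

Lemma dot_riccati (t : R) x : 0 <= t ->
  dot x (M' t *m x) = 2 * dot x (A *m (M t *m x)) -
    dot (C t *m (M t *m x)) (Q *m (C t *m (M t *m x))) + dot x (S *m x).
Proof.
move=> t0; rewrite /M' !mulmxDl mulNmx !dotDr dotNr.
have -> : dot x (M t *m A^T *m x) = dot x (A *m (M t *m x)).
  by rewrite -mulmxA dot_mulmxr M_sym// dot_mulmxr trmxK dotC.
have -> : dot x (M t *m (C t)^T *m Q *m C t *m M t *m x) =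
   dot (C t *m (M t *m x)) (Q *m (C t *m (M t *m x))).
  by rewrite -!mulmxA dot_mulmxr M_sym// dot_mulmxr trmxK.
by rewrite -mulmxA; ring.
Qed.

(* Dual Kalman argument: y is the adjoint trajectory ending at z which an
   explicit input w = C Phi theta brings to 0 one window earlier, and the
   Riccati equation bounds the growth of y^T M y by the cost of w. *)
Lemma riccati_ub : exists K : R, forall t x, 0 < t ->
  dot x (M t *m x) <= K * dot x x.
Proof.
have [T [c [T0 c0 obs]]] := observable.
have [qq qq0 HQ] := pd_coercive pdQ.
have [B0 HB0] : exists B, forall s, 0 <= s <= T -> mxsq (M s) <= B.
  exact: mxcont_bounded M_cont (ltW T0).
pose b0 := 2 * mxsq (1%:M : 'M[R]_N) + 2 * (T ^+ 2 * mxsq A).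
have b00 : 0 <= b0.
  have := mxsq_ge0 (1%:M : 'M[R]_N).
  have : 0 <= T ^+ 2 * mxsq A by rewrite mulr_ge0 ?sqr_ge0 ?mxsq_ge0.
  by rewrite /b0 => *; lra.
have flow_le (X : 'M[R]_N) h : mxsq X = mxsq A -> `|h| <= T -> mxsq (1%:M + h *: X) <= b0.
  move=> XA hT; apply: le_trans (mxsqD _ _) _; rewrite lerD2l ler_pM2l// mxsqZ XA.
  rewrite ler_wpM2r ?mxsq_ge0// -real_normK ?num_real// lerXn2r ?nnegrE//.
  exact: ltW.
(* Bounds each entry of the Gramian integrand, whose square is at most (Kc b0)^2; |r| <= 1 + r^2
   avoids a square root. *)
pose B1 := 1 + (Kc * b0) * (Kc * b0).
pose b2 := b0 * ((N * N)%:R * (B1 * T) ^+ 2).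
(* Bounds the derivative of y^T M y per unit of |th|^2: the first term is the cost of [w] after
   completing the square against [Q], the second is the contribution of [S]. *)
pose L := qq^-1 * (Kc * b0) + (1 + mxsq S) * b2.
exists ((1 + B0) + L * T * (c ^+ 2)^-1) => t z t0.
have KB0 : 0 <= Kc * b0 by exact: mulr_ge0.
have B10 : 0 <= B1 by rewrite addr_ge0// mulr_ge0.
have b20 : 0 <= b2 by rewrite mulr_ge0// mulr_ge0// sqr_ge0.
have S0 : 0 <= 1 + mxsq S by rewrite addr_ge0// mxsq_ge0.
have L0 : 0 <= L.
  by rewrite addr_ge0//; apply: mulr_ge0; rewrite // invr_ge0 ltW.
have B00 : 0 <= B0.
  by apply: le_trans (HB0 0 _); rewrite ?mxsq_ge0// lexx ltW.
(* Before a full window has elapsed, compactness of [0, T] replaces observability. *)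
have [tT|Tt] := leP t T.
  apply: le_trans (ler_norm _) _; apply: le_trans (quad_le _ _) _.
  rewrite ler_wpM2r ?dot_ge0// -addrA lerD2l -[leLHS]addr0 lerD//.
    by rewrite HB0// tT ltW.
  by rewrite !mulr_ge0// ?invr_ge0 ?exprn_ge0// ltW.
suff h : dot z (M t *m z) <= L * T * (c ^+ 2)^-1 * dot z z.
  apply: le_trans h _; rewrite ler_wpM2r ?dot_ge0// lerDr; lra.
pose Fl s := 1%:M + (s - t) *: A.
pose X s := (C s *m Fl s)^T *m (C s *m Fl s).
have cFl : mxcont 0 Fl.
  apply: mxcontD; first exact: mxcont_cst.
  apply: mxcontZ; last exact: mxcont_cst.
  apply: continuous_subspaceT => s.
  exact: der_continuous (derD (der_id s) (der_cst (- t) s)).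
have [Y [dY _]] : exists F : R -> 'M[R]_N, (forall t, 0 < t -> mxder F t (X t)) /\
    forall a b, 0 < a -> a < b -> intmx X a b = F b - F a.
  by apply: mx_primitive_exists; apply: mxcontM;
    [apply: mxcont_tr|]; apply: mxcontM.
pose t1 := t - T.
have t10 : 0 < t1 by rewrite subr_gt0.
have Ht1 s : t1 <= s <= t -> 0 < s by move=> /andP[h _]; exact: lt_le_trans h.
have cG := obs t Y Tt (fun s h => dY s (Ht1 s h)).
set G := Y t - Y (t - T) in cG.
(* With this choice [y] below vanishes at [t1] and equals [z] at [t]. *)
pose th := invmx G *m z.
have uG := coercive_unit c0 cG.
have th_le : dot th th <= (c ^+ 2)^-1 * dot z z := coercive_invmx c0 cG z.
(* The flow of - A^T, which is inverse to the transpose of [Fl s]; both are affine because A^2 =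
   0. *)
pose E s := 1%:M - (s - t) *: A^T.
pose y s := E s *m ((Y s - Y t1) *m th).
pose w s := C s *m (Fl s *m th).
have At2 : A^T *m A^T = 0 by rewrite -trmx_mul A_sq trmx0.
have EFl s : E s *m (Fl s)^T = 1%:M.
  have -> : (Fl s)^T = 1%:M + (s - t) *: A^T.
    by rewrite /Fl raddfD /= tr_scalar_mx linearZ.
  rewrite /E mulmxBl mul1mx mulmxDr mulmx1.
  by rewrite -scalemxAl -scalemxAr At2 !scaler0 addr0 addrK.
have dy s : t1 <= s <= t -> mxder y s (- (A^T *m y s) + (C s)^T *m w s).
  move=> hs; have s0 := Ht1 s hs.
  have dE : mxder E s (- A^T).
    have d1 : is_derive s 1 (fun s : R => s - t) 1.
      by apply: der_eq (derD (der_id s) (derN (der_cst t s))) _; rewrite oppr0 addr0.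
    apply: mxder_eq (mxderB (mxder_cst 1%:M s) (mxderZ d1 (mxder_cst A^T s))) _.
    by rewrite scaler0 addr0 scale1r sub0r.
  have dYth : mxder (fun s => (Y s - Y t1) *m th) s (X s *m th).
    apply: mxderMr; apply: mxder_eq (mxderB (dY s s0) (mxder_cst (Y t1) s)) _.
    by rewrite subr0.
  apply: mxder_eq (mxderM dE dYth) _.
  congr (_ + _).
    have AE : A^T *m E s = A^T.
      by rewrite /E mulmxBr mulmx1 -scalemxAr At2 scaler0 subr0.
    by rewrite mulNmx /y -{1}AE -mulmxA.
  by rewrite /X trmx_mul /w !mulmxA EFl mul1mx.
pose f s := dot (y s) (M s *m y s).
have df s : t1 <= s <= t -> exists2 b, is_derive s 1 f b & b <= L * dot th th.
  move=> hs; have s0 := Ht1 s hs.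
  have := der_quad (M_der s0) (dy s hs).
  set b := (X in is_derive _ _ _ X) => Hb; exists b => // {Hb}.
  (* The terms in [A] cancel, since [y] follows the adjoint of the flow that drives [M]. What
     remains is concave in C M y, up to the term in [S]. *)
  have -> : b = 2 * dot (w s) (C s *m (M s *m y s))
      - dot (C s *m (M s *m y s)) (Q *m (C s *m (M s *m y s)))
      + dot (y s) (S *m y s).
    have Mr k : dot (y s) (M s *m k) = dot (M s *m y s) k.
      by rewrite dot_mulmxr M_sym// ltW.
    have ATr : dot (A^T *m y s) (M s *m y s) = dot (y s) (A *m (M s *m y s)).
      by rewrite -dot_mulmxr.
    have CTr : dot ((C s)^T *m w s) (M s *m y s) = dot (w s) (C s *m (M s *m y s)).
      by rewrite -dot_mulmxr.
    rewrite /b [dot (y s) (_ + _)]dotDr dot_riccati ?ltW// Mr [dot (M s *m _) _]dotC.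
    by rewrite dotDl dotNl ATr CTr; ring.
  have hst : `|s - t| <= T.
    by move/andP: hs => [h1 h2]; rewrite ler_norml; apply/andP; split;
      move: h1; rewrite /t1; lra.
  have Flb : mxsq (Fl s) <= b0 by exact: flow_le.
  have Eb : mxsq (E s) <= b0.
    by rewrite /E -scaleNr; apply: flow_le; rewrite ?mxsq_tr ?normrN.
  have wb : dot (w s) (w s) <= Kc * b0 * dot th th.
    rewrite /w mulmxA; apply: le_trans (dot_mulmx_le _ _) _.
    rewrite ler_wpM2r ?dot_ge0//; apply: le_trans (mxsq_mul _ _) _.
    by rewrite ler_pM ?mxsq_ge0// C_le// ltW.
  have yb : dot (y s) (y s) <= b2 * dot th th.
    rewrite /y mulmxA; apply: le_trans (dot_mulmx_le _ _) _.
    rewrite ler_wpM2r ?dot_ge0//; apply: le_trans (mxsq_mul _ _) _.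
    rewrite ler_pM ?mxsq_ge0//; apply: mxsq_le => i j; rewrite 2!mxE.
    have Xb r : t1 <= r <= t -> `|X r i j| <= B1.
      move=> hr; have r0 := Ht1 r hr.
      have hrt : `|r - t| <= T.
        by move/andP: hr => [k1 k2]; rewrite ler_norml; apply/andP; split;
          move: k1; rewrite /t1; lra.
      have X2 : X r i j ^+ 2 <= (Kc * b0) * (Kc * b0).
        apply: le_trans (_ : mxsq (X r) <= _).
          rewrite /mxsq (bigD1 i)//= (bigD1 j)//= -addrA lerDl addr_ge0//;
            do ?[apply: sumr_ge0 => ? _]; exact: sqr_ge0.
        have CF : mxsq (C r *m Fl r) <= Kc * b0.
          apply: le_trans (mxsq_mul _ _) _.
          by apply: ler_pM; rewrite ?mxsq_ge0 ?C_le ?(ltW r0)//; exact: flow_le.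
        apply: le_trans (mxsq_mul _ _) _; rewrite mxsq_tr.
        by rewrite ler_pM ?mxsq_ge0.
      have := sqr_ge0 (X r i j - 1); have := sqr_ge0 (X r i j + 1).
      by rewrite ler_norml !expr2 in X2 * => *; rewrite /B1; apply/andP; split; lra.
    have /andP[h1 h2] := hs.
    have u1 := @der_ub _ (fun r => Y r i j) (fun r => X r i j) B1 t1 s h1.
    have u2 := @der_lb _ (fun r => Y r i j) (fun r => X r i j) (- B1) t1 s h1.
    have {}u1 : Y s i j - Y t1 i j <= B1 * (s - t1).
      apply: u1 => r /andP[r1 r2]; first by apply: dY; exact: lt_le_trans r1.
      by have := Xb r; rewrite r1 (le_trans r2)// ler_norml => /(_ isT) /andP[].
    have {}u2 : - B1 * (s - t1) <= Y s i j - Y t1 i j.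
      apply: u2 => r /andP[r1 r2]; first by apply: dY; exact: lt_le_trans r1.
      by have := Xb r; rewrite r1 (le_trans r2)// ler_norml => /(_ isT) /andP[].
    have u3 : B1 * (s - t1) <= B1 * T.
      by apply: ler_wpM2l => //; rewrite /t1; lra.
    by rewrite ler_norml; apply/andP; split; move: u1 u2 u3; rewrite ?mxE; lra.
  have h1 := dot_young (C s *m (M s *m y s)) (w s) qq0.
  have h2 := HQ (C s *m (M s *m y s)).
  have h3 := quad_le S (y s); have h4 := ler_norm (dot (y s) (S *m y s)).
  have h5 : (1 + mxsq S) * dot (y s) (y s) <= (1 + mxsq S) * (b2 * dot th th).
    by rewrite ler_wpM2l// addr_ge0// mxsq_ge0.
  have h6 : qq^-1 * dot (w s) (w s) <= qq^-1 * (Kc * b0 * dot th th).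
    by rewrite ler_wpM2l// invr_ge0 ltW.
  move: h1; rewrite dotC /L; lra.
have [f' Hf'] : exists f' : R -> R, forall s, t1 <= s <= t ->
    is_derive s 1 f (f' s) /\ f' s <= L * dot th th.
  suff /choice[f' Hf'] : forall s : R, exists b : R, t1 <= s <= t ->
      is_derive s 1 f b /\ b <= L * dot th th by exists f'.
  move=> s; have [/df[b ? ?]|hs] := boolP (t1 <= s <= t); first by exists b.
  by exists 0.
have t1t : t1 <= t by rewrite /t1; lra.
have := der_ub t1t (fun s h => (Hf' s h).1) (fun s h => (Hf' s h).2).
have -> : f t1 = 0 by rewrite /f /y subrr mul0mx mulmx0 dot0l.
have -> : f t = dot z (M t *m z).
  have yt : y t = z.
    by rewrite /y /E subrr scale0r subr0 mul1mx /th mulmxA mulmxV ?mul1mx.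
  by rewrite /f yt.
rewrite subr0 (_ : t - t1 = T); last by rewrite /t1; ring.
move=> h; apply: le_trans h _.
rewrite mulrAC -[leRHS]mulrA ler_wpM2l//.
by rewrite mulr_ge0// ltW.
Qed.

End riccati_bounds.

(** * Decay of the errors of the relative observers *)

Section relative_observer.
Context {R : realType}.

Lemma riccati_lyapunov (N q : nat) (A S : 'M[R]_N) (Q : 'M[R]_q)
    (C : R -> 'M[R]_(q, N)) (M : R -> 'M[R]_N) (m1 K kappa : R) :
  0 < m1 -> pdmx Q -> pdmx S -> 2^-1 <= kappa ->
  (forall t : R, 0 < t -> (M t)^T = M t) ->
  (forall (t : R) x, 0 < t -> m1 * dot x x <= dot x (M t *m x)) ->
  (forall (t : R) x, 0 < t -> dot x (M t *m x) <= K * dot x x) ->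
  (forall t : R, 0 < t -> mxder M t
    (A *m M t + M t *m A^T - M t *m (C t)^T *m Q *m C t *m M t + S)) ->
  (forall (t : R) x, 0 < t -> dot x ((A *m M t + M t *m A^T
      - M t *m (C t)^T *m Q *m C t *m M t + S) *m x) =
    2 * dot x (A *m (M t *m x)) -
    dot (C t *m (M t *m x)) (Q *m (C t *m (M t *m x))) + dot x (S *m x)) ->
  exists c1 c2 l : R, [/\ 0 < c1, 0 < c2, 0 < l,
    forall (t : R) x, 0 < t -> c1 * dot x x <= dot x (invmx (M t) *m x) <= c2 * dot x x
  & forall (t : R) (x : R -> 'cV[R]_N), 0 < t ->
      mxder x t (A *m x t - kappa *: (M t *m (C t)^T *m Q) *m C t *m x t) ->
      exists2 b, is_derive t 1 (fun s => dot (x s) (invmx (M s) *m x s)) b &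
        b <= - l * dot (x t) (invmx (M t) *m x t)].
Proof.
move=> m10 pdQ pdS kappa2 M_sym M_lb M_ub M_der M_quad.
have [sg sg0 HS] := pd_coercive pdS; have [qq qq0 HQ] := pd_coercive pdQ.
(* [K] comes without a sign, and a positive bound is needed to divide by. *)
pose K1 := 1 + `|K|.
have K10 : 0 < K1 by rewrite ltr_wpDr.
have {}M_ub (t : R) x : 0 < t -> dot x (M t *m x) <= K1 * dot x x.
  move=> t0; apply: le_trans (M_ub t x t0) _; rewrite ler_wpM2r ?dot_ge0//.
  by rewrite /K1; have := ler_norm K; lra.
have uM (t : R) : 0 < t -> M t \in unitmx.
  by move=> t0; apply: (@coercive_unit _ _ _ m1) => // x; exact: M_lb.
have MV (t : R) (x : 'cV[R]_N) : 0 < t -> M t *m (invmx (M t) *m x) = x.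
  by move=> t0; rewrite mulKVmx// uM.
(* With x = M xi the form is xi^T M xi. It is at least |M xi|^2 / K1 and at most K1 |xi|^2, where
   |xi|^2 <= |x|^2 / m1^2; the rate compares it with sg |xi|^2. *)
exists K1^-1, (K1 * (m1 ^+ 2)^-1), (sg / K1); split.
- by rewrite invr_gt0.
- by rewrite mulr_gt0// invr_gt0 exprn_gt0.
- by rewrite divr_gt0.
- move=> t x t0; set xi := invmx (M t) *m x.
  have -> : dot x xi = dot xi (M t *m xi) by rewrite MV// dotC.
  have psdM : psdmx (M t).
    split; first exact: M_sym.
    move=> y; rewrite quadE; apply: le_trans (M_lb t y t0).
    by rewrite mulr_ge0 ?dot_ge0// ltW.
  apply/andP; split.
    rewrite ler_pdivrMl// -{1 2}(MV t x t0); apply: psd_mul_le_bound => // y.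
    exact: M_ub.
  apply: le_trans (M_ub t xi t0) _; rewrite -mulrA ler_pM2l//.
  by apply: coercive_invmx => // y; exact: M_lb.
move=> t x t0 dx.
have dM := M_der t t0; have := fun y => M_quad t y t0.
set D := (_ + S) in dM * => D_quad; clearbody D.
have dP := mxder_invmx dM (uM t t0).
have := der_quad dP dx.
set b := (X in is_derive _ _ _ X) => Hb; exists b => // {Hb}.
set xi := invmx (M t) *m x t in b *.
have xiE : M t *m xi = x t by rewrite MV.
have Psym y : dot (x t) (invmx (M t) *m y) = dot xi y.
  by rewrite dot_mulmxr trmx_inv M_sym.
set X := A *m x t - _ in b dx *.
have xiX : dot xi X = dot xi (A *m x t) -
    kappa * dot (C t *m x t) (Q *m (C t *m x t)).
  rewrite /X dotBr -!scalemxAl dotZr; congr (_ - _ * _).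
  by rewrite -!mulmxA dot_mulmxr M_sym// xiE dot_mulmxr trmxK.
(* The Riccati equation adds one copy of the output form and the innovation removes [2 * kappa]
   copies. *)
have bE : b = - ((2 * kappa - 1) * dot (C t *m x t) (Q *m (C t *m x t))
    + dot xi (S *m xi)).
  rewrite /b [dot (x t) (_ + _)]dotDr Psym mulNmx dotNr -!mulmxA Psym -/xi.
  by rewrite D_quad xiE (dotC X) xiX; ring.
have h1 : 0 <= (2 * kappa - 1) * dot (C t *m x t) (Q *m (C t *m x t)).
  apply: mulr_ge0; first lra.
  by apply: le_trans (HQ _); rewrite mulr_ge0 ?dot_ge0// ltW.
have h2 := HS xi.
have h3 : sg / K1 * dot (x t) xi <= sg * dot xi xi.
  rewrite -mulrA ler_pM2l// ler_pdivrMl// -{1}xiE dotC; exact: M_ub.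
by rewrite bE mulNr; lra.
Qed.

Lemma output_C_col (d : nat) (g a b : 'cV[R]_d) :
  output_C g *m col_mx a b = orth_proj g *m a.
Proof. by rewrite -mulmxA mul_row_col mul1mx mul0mx addr0. Qed.

(** The true relative state produces no innovation, since the bearing's projection annihilates the
    relative position; it therefore solves the observer's equation, and the difference of two
    solutions is unforced. *)
Lemma relative_error_der (d : nat) (t0 t kappa : R) (g ub pt vt : R -> 'cV[R]_d)
    (Q : 'M[R]_d) (M : R -> 'M[R]_(d + d)) (pb vb : R -> 'cV[R]_d) :
  relative_observer t0 g ub kappa Q M pb vb -> t0 < t ->
  mxder pt t (vt t) -> mxder vt t (ub t) -> orth_proj (g t) *m pt t = 0 ->
  let x s := col_mx (pb s - pt s) (vb s - vt s) in
  mxder x t (integrator_A R d *m x t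
    - kappa *: (M t *m (output_C (g t))^T *m Q) *m output_C (g t) *m x t).
Proof.
move=> obs t0t dp dv gp x.
have xE s : x s = col_mx (pb s) (vb s) - col_mx (pt s) (vt s).
  by rewrite /x opp_col_mx add_col_mx.
have -> : x = fun s => col_mx (pb s) (vb s) - col_mx (pt s) (vt s) by exact/funext.
apply: mxder_eq (mxderB (solution_mxder obs t0t) (mxder_col dp dv)) _.
rewrite /riccati_gain /integrator_B /= !mulmxBr.
have -> : integrator_A R d *m col_mx (pt t) (vt t) = col_mx (vt t) 0.
  exact: integrator_A_col.
have -> : kappa *: (M t *m (output_C (g t))^T *m Q) *m output_C (g t) *m
    col_mx (pt t) (vt t) = 0.
  by rewrite -mulmxA output_C_col gp mulmx0.
have -> : col_mx (vt t) (ub t) = col_mx (vt t) 0 + col_mx 0 1%:M *m ub t.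
  by rewrite mul_col_mx mul0mx mul1mx add_col_mx addr0 add0r.
rewrite subr0; move: (_ *m ub t) (_ *m _ *m col_mx (pb t) _) (_ *m col_mx _ _) => a b c.
by apply/matrixP => i j; rewrite !mxE; ring.
Qed.

Lemma edge_lyapunov (d : nat) (g : R -> 'cV[R]_d) (kappa : R) (Q : 'M[R]_d)
    (S : 'M[R]_(d + d)) (M : R -> 'M[R]_(d + d)) :
  (forall t : R, 0 <= t -> dot (g t) (g t) = 1) -> mxcont 0 g -> PE g ->
  2^-1 <= kappa -> pdmx Q -> pdmx S -> riccati_solution g Q S M ->
  exists c1 c2 l : R, [/\ 0 < c1, 0 < c2, 0 < l,
    forall (t : R) x, 0 < t -> c1 * dot x x <= dot x (invmx (M t) *m x) <= c2 * dot x x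
  & forall (t : R) (x : R -> 'cV[R]_(d + d)), 0 < t ->
      mxder x t (integrator_A R d *m x t
        - kappa *: (M t *m (output_C (g t))^T *m Q) *m output_C (g t) *m x t) ->
      exists2 b, is_derive t 1 (fun s => dot (x s) (invmx (M s) *m x s)) b &
        b <= - l * dot (x t) (invmx (M t) *m x t)].
Proof.
move=> g1 cg PEg kappa2 pdQ pdS [pdM0 solM].
have cM := solution_mxcont solM; have dM t t0 := @solution_mxder _ _ _ _ _ _ t solM t0.
have cC : mxcont 0 (fun t => output_C (g t)).
  apply: mxcontM; last exact: mxcont_cst.
  apply: mxcontD; first exact: mxcont_cst.
  by apply: mxcontN; apply: mxcontM => //; exact: mxcont_tr.
have C_le (t : R) : 0 <= t ->
    mxsq (output_C (g t)) <= d%:R * mxsq (row_mx 1%:M 0 : 'M[R]_(d, d + d)).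
  move=> t0; apply: le_trans (mxsq_mul _ _) _; rewrite ler_wpM2r ?mxsq_ge0//.
  by apply: mxsq_orth_proj; exact: g1.
have [m1 m10 lb] := riccati_lb pdM0 pdQ pdS C_le cM dM.
have [K ub] := riccati_ub pdM0 pdQ pdS C_le cC cM dM (integrator_A_sq (d := d))
  (PE_observable g1 cg PEg).
apply: (riccati_lyapunov m10 pdQ pdS kappa2 _ _ ub dM).
- by move=> t t0; exact: (riccati_sym pdM0 pdQ pdS C_le cM dM (ltW t0)).
- by move=> t x t0; exact: lb (ltW t0).
- by move=> t x t0; exact: (dot_riccati pdM0 pdQ pdS C_le cM dM x (ltW t0)).
Qed.

End relative_observer.

(** * Formations *)

Section blocks.
Context {R : realType}.
Implicit Types n d : nat.

Definition blk n d (x : 'cV[R]_(n * d)) (i : 'I_n) : 'cV[R]_d :=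
  \col_a x (mxtens_index (i, a)) 0.

Lemma blk_stack n d (f : 'I_n -> 'cV[R]_d) i : blk (stack f) i = f i.
Proof. by apply/matrixP => a j; rewrite !mxE mxtens_indexK /= ord1. Qed.

Lemma blk_inj n d (x y : 'cV[R]_(n * d)) : (forall i, blk x i = blk y i) -> x = y.
Proof.
move=> xy; apply/matrixP => c j; rewrite ord1.
case: (mxtens_indexP c) => i a.
by have /matrixP/(_ a 0) := xy i; rewrite !mxE.
Qed.

Lemma blkD n d (x y : 'cV[R]_(n * d)) i : blk (x + y) i = blk x i + blk y i.
Proof. by apply/matrixP => a j; rewrite !mxE. Qed.

Lemma blkN n d (x : 'cV[R]_(n * d)) i : blk (- x) i = - blk x i.
Proof. by apply/matrixP => a j; rewrite !mxE. Qed.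

Lemma sum_tens n d (F : 'I_(n * d) -> R) :
  \sum_c F c = \sum_i \sum_a F (mxtens_index (i, a)).
Proof.
rewrite pair_big /= (reindex (@mxtens_index n d)) /=; last first.
  by exists (@mxtens_unindex n d) => c _; [exact: mxtens_indexK|exact: mxtens_unindexK].
by apply: eq_bigr => -[i a].
Qed.

Lemma dot_blk n d (x y : 'cV[R]_(n * d)) :
  dot x y = \sum_i dot (blk x i) (blk y i).
Proof.
rewrite dotE sum_tens; apply: eq_bigr => i _; rewrite dotE.
by apply: eq_bigr => a _; rewrite !mxE.
Qed.

Lemma blk_blkdiag n d (X : 'I_n -> 'M[R]_d) x i :
  blk (blkdiag X *m x) i = X i *m blk x i.
Proof.
apply/matrixP => a j; rewrite !mxE sum_tens (bigD1 i)//= [X in _ + X]big1.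
  rewrite addr0; apply: eq_bigr => b _; rewrite !mxE; congr (_ * _).
  rewrite summxE (bigD1 i)//= big1 ?addr0 => [|k ki];
    rewrite tensmxE mxE ?eqxx ?mul1r//.
  by rewrite eq_sym (negbTE ki) mul0r.
move=> k ki; apply: big1 => b _; rewrite summxE big1 ?mul0r// => l _.
rewrite tensmxE mxE; case: eqVneq => [il|]; last by rewrite mul0r.
by case: eqVneq => [kl|]; rewrite ?mul0r//; rewrite kl -il eqxx in ki.
Qed.

Lemma blk_Hbar n m d (src tgt : 'I_m -> 'I_n) (x : 'cV[R]_(n * d)) k :
  blk (Hbar R d src tgt *m x) k = blk x (tgt k) - blk x (src k).
Proof.
apply/matrixP => a j; rewrite !mxE sum_tens.
have E i : \sum_b Hbar R d src tgt (mxtens_index (k, a)) (mxtens_index (i, b)) *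
      x (mxtens_index (i, b)) 0 =
    (i == tgt k)%:R * x (mxtens_index (i, a)) 0 -
    (i == src k)%:R * x (mxtens_index (i, a)) 0.
  rewrite (bigD1 a)//= big1 ?addr0 => [|b ba]; rewrite /Hbar tensmxE !mxE.
    by rewrite eqxx mulr1 mulrBl.
  by rewrite [a == b]eq_sym (negbTE ba) mulr0 mul0r.
under eq_bigr do rewrite E; rewrite big_split /= sumrN; congr (_ - _).
  by rewrite (bigD1 (tgt k))//= big1 => [|i /negbTE->];
    rewrite ?mul0r// eqxx mul1r addr0.
by rewrite (bigD1 (src k))//= big1 => [|i /negbTE->];
  rewrite ?mul0r// eqxx mul1r addr0.
Qed.

Lemma blkdiag_tr n d (X : 'I_n -> 'M[R]_d) :
  (forall i, (X i)^T = X i) -> (blkdiag X)^T = blkdiag X.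
Proof.
move=> XT; rewrite /blkdiag raddf_sum; apply: eq_bigr => i _.
by rewrite /= trmx_tens XT trmx_delta.
Qed.

Lemma mxcont_blkdiag n d (X : 'I_n -> R -> 'M[R]_d) t0 :
  (forall i, mxcont t0 (X i)) -> mxcont t0 (fun t => blkdiag (X^~ t)).
Proof.
move=> cX c c'; case: (mxtens_indexP c) => i a; case: (mxtens_indexP c') => j b.
apply: (@within_continuous_ext _ (fun s => \sum_k
    (delta_mx k k : 'M[R]_n) i j * X k s a b)).
  by move=> s; rewrite summxE; apply: eq_bigr => k _; rewrite tensmxE.
apply: within_continuous_sum => k; apply: within_continuousM; last exact: cX.
by move=> x; exact: cst_continuous.
Qed.

Lemma mxder_stack n d (x : 'I_n -> R -> 'cV[R]_d) (x' : 'I_n -> 'cV[R]_d) t :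
  (forall i, mxder (x i) t (x' i)) -> mxder (fun s => stack (x^~ s)) t (stack x').
Proof.
move=> dx c j; rewrite mxE.
under eq_fun do rewrite mxE; exact: dx.
Qed.

Lemma mxcont_stack n d (x : 'I_n -> R -> 'cV[R]_d) t0 :
  (forall i, mxcont t0 (x i)) -> mxcont t0 (fun s => stack (x^~ s)).
Proof.
move=> cx c j; apply: (@within_continuous_ext _ (fun s =>
  x (mxtens_unindex c).1 s (mxtens_unindex c).2 0)); first by move=> s; rewrite mxE.
exact: cx.
Qed.

End blocks.

(** * Positive definiteness of the constant matrix of the agents' error *)

Section formation.
Context {R : realType} {d n m : nat}.
Variables (e : rel 'I_n) (src tgt : 'I_m -> 'I_n) (p : 'I_n -> R -> 'cV[R]_d).
Hypothesis n_gt0 : (0 < n)%N.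
Hypothesis orient : edge_orientation e src tgt.
Hypothesis p_cont : forall i, mxcont 0 (p i).
Hypothesis bearings_defined : forall i j, e i j ->
  forall t : R, 0 <= t -> p j t - p i t != 0.
Hypothesis nonPE_constant : forall k, ~ PE (edge_bearing src tgt p k) ->
  constant_direction (edge_bearing src tgt p k).

Let g := edge_bearing src tgt p.
Let H := Hbar R d src tgt.

Lemma edge_bearing_unit k (t : R) : 0 <= t -> dot (g k t) (g k t) = 1.
Proof.
move=> t0; apply: dot_bearing; apply: bearings_defined => //.
exact: orient.1.
Qed.

Lemma edge_bearing_cont k : mxcont 0 (g k).
Proof.
apply: mxcont_bearing; last first.
  by move=> t t0; apply: bearings_defined => //; exact: orient.1.
by apply: mxcontD; [exact: p_cont|apply: mxcontN; exact: p_cont].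
Qed.

Let sig k t : 'M[R]_d :=
  if `[< PE (g k) >] then 1%:M else orth_proj (g k t).

Lemma Sigma_bar_constant (t : R) :
  0 <= t -> Sigma_bar src tgt p t = Sigma_bar src tgt p 0.
Proof.
move=> t0; apply: eq_bigr => k _; case: asboolP => // /nonPE_constant[y yE].
by rewrite !yE.
Qed.

(* Under hypothesis (4), Sigma_bar does not depend on time. *)
Definition stiffness : 'M[R]_(n * d) :=
  H^T *m Sigma_bar src tgt p 0 *m H + leader_C R d n.

Lemma dot_stiffness x : dot x (stiffness *m x) =
  \sum_k dot (blk (H *m x) k) (sig k 0 *m blk (H *m x) k) +
  dot (blk x (Ordinal n_gt0)) (blk x (Ordinal n_gt0)).
Proof.
rewrite mulmxDl dotDr -!mulmxA dot_mulmxr trmxK dot_blk; congr (_ + _).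
  by apply: eq_bigr => k _; rewrite blk_blkdiag.
rewrite dot_blk (bigD1 (Ordinal n_gt0))//= big1 ?addr0 => [|i i0].
  by rewrite blk_blkdiag mul1mx.
rewrite blk_blkdiag ifF ?mul0mx ?dot0r//; apply: contraNF i0 => /eqP i0.
exact/eqP/val_inj.
Qed.

Hypothesis bpe : BPE e src tgt p.

Let sig_ge k (t : R) y : 0 <= t ->
  dot y (orth_proj (g k t) *m y) <= dot y (sig k 0 *m y).
Proof.
move=> t0; rewrite /sig; case: asboolP => [_|/nonPE_constant[y0 yE]].
  by rewrite mul1mx -dot_orth_proj ?edge_bearing_unit// orth_proj_le ?edge_bearing_unit.
by rewrite /g !yE.
Qed.

Let sig_ge0 k y : 0 <= dot y (sig k 0 *m y).
Proof.
apply: le_trans (sig_ge _ _ (lexx 0)).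
by rewrite -dot_orth_proj ?edge_bearing_unit// dot_ge0.
Qed.

Let bpe_le : exists2 mu : R, 0 < mu & forall x,
  mu * dot (H *m x) (H *m x) <=
  \sum_k dot (blk (H *m x) k) (sig k 0 *m blk (H *m x) k).
Proof.
have [_ [T [mu [T0 mu0 Hmu]]]] := bpe; exists mu => // x.
have [F [dF FE]] : exists F : R -> 'M[R]_(n * d),
    (forall t, 0 < t -> mxder F t (bearing_laplacian src tgt p t)) /\
    forall a b, 0 < a -> a < b ->
      intmx (bearing_laplacian src tgt p) a b = F b - F a.
  apply: mx_primitive_exists; apply: mxcontM; last exact: mxcont_cst.
  apply: mxcontM; first exact: mxcont_cst.
  apply: (@mxcont_blkdiag _ _ _ (fun k t => orth_proj (g k t))) => k.
  apply: mxcontD; first exact: mxcont_cst.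
  apply: mxcontN; apply: mxcontM; last apply: mxcont_tr; exact: edge_bearing_cont.
set K := \sum_k _.
(* The window starts at 1 because the primitive is only known at positive times. *)
have := @der_ub _ (fun s => dot x (F s *m x))
  (fun s => dot x (bearing_laplacian src tgt p s *m x)) K 1 (1 + T).
have -> : 1 + T - 1 = T by ring.
move=> h; have {}h : dot x (F (1 + T) *m x) - dot x (F 1 *m x) <= K * T.
  apply: h => [|s /andP[s1 _]|s /andP[s1 _]]; first by rewrite lerDl ltW.
    by apply: der_quad_cst; apply: dF; exact: lt_le_trans s1.
  rewrite -!mulmxA dot_mulmxr trmxK dot_blk; apply: ler_sum => k _.
  rewrite blk_blkdiag; apply: sig_ge; exact: le_trans s1.
have [_ /(_ x)] := Hmu 1 ler01.
rewrite quadE mulmxBl dotBr -!scalemxAl !dotZr FE ?ltrDl// mulmxBl dotBr.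
rewrite -[laplacian _ _ _ _ *m x]mulmxA [dot x (_^T *m _)]dot_mulmxr trmxK subr_ge0.
rewrite ler_pdivlMl//.
rewrite mulrC => /le_trans/(_ h).
by rewrite ler_pM2r.
Qed.

Lemma stiffness_pd : pdmx stiffness.
Proof.
have St : (Sigma_bar src tgt p 0)^T = Sigma_bar src tgt p 0.
  by apply: blkdiag_tr => k; case: ifP => _; rewrite ?tr_scalar_mx ?orth_proj_tr.
have Ct : (leader_C R d n)^T = leader_C R d n.
  by apply: blkdiag_tr => k; case: ifP => _; rewrite ?tr_scalar_mx ?trmx0.
split; first by rewrite raddfD /= !trmx_mul trmxK St Ct mulmxA.
have [mu mu0 Hmu] := bpe_le.
move=> x x0; rewrite quadE dot_stiffness lt_def.
have h0 : 0 <= \sum_k dot (blk (H *m x) k) (sig k 0 *m blk (H *m x) k).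
  by apply: sumr_ge0 => k _; exact: sig_ge0.
rewrite addr_ge0 ?dot_ge0// andbT; apply: contra x0.
rewrite paddr_eq0 ?dot_ge0// dot_eq0 => /andP[/eqP s0 /eqP b0].
have /eqP : dot (H *m x) (H *m x) = 0.
  apply/le_anti; rewrite dot_ge0 andbT -(pmulr_rle0 _ mu0) -s0.
  exact: Hmu.
rewrite dot_eq0 => /eqP Hx.
(* As H x = 0, the blocks of [x] agree along every edge, whatever its orientation; connectedness
   then carries the zero block of the leader to all agents. *)
have step i j : e i j -> blk x i = blk x j.
  move=> /orient.2[k [+ _]].
  have := blk_Hbar src tgt x k; rewrite -/H Hx.
  have -> : blk (0 : 'cV[R]_(m * d)) k = 0 by apply/matrixP => a b; rewrite !mxE.
  by move=> /esym/eqP; rewrite subr_eq0 => /eqP E [][<- <-].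
have cst i : blk x i = 0.
  rewrite -b0; have /connectP[s] := bpe.1 i (Ordinal n_gt0).
  elim: s i => [|j s IH] i /=; first by move=> _ ->.
  by move=> /andP[ij js] /(IH j js) <-; exact: step.
by apply/eqP/blk_inj => i; rewrite cst; apply/matrixP => a b; rewrite !mxE.
Qed.

End formation.

(** * Lyapunov functions of the error system *)

Section agents.
Context {R : realType}.

(** With the weight [k2 / 2] the terms in b^T P a cancel in the derivative of the first two
    summands, which leaves no dissipation in [b]; the cross term supplies - eps |b|^2. *)
Definition agent_energy N (P : 'M[R]_N) (k2 eps : R) (a b : 'cV[R]_N) : R :=
  k2 / 2 * dot a (P *m a) + 2^-1 * dot b b - eps * dot a b.

Lemma agent_lyapunov N (P : 'M[R]_N) (k1 k2 : R) :
  pdmx P -> 0 < k1 -> 0 < k2 ->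
  exists eps c1 c2 l K : R, [/\ 0 < c1 <= c2, 0 < l, 0 <= K,
    forall a b, c1 * (dot a a + dot b b) <= agent_energy P k2 eps a b <=
                c2 * (dot a a + dot b b)
  & forall (t : R) (a b : R -> 'cV[R]_N) f,
      mxder a t (b t + k1 *: (f - P *m a t)) -> mxder b t (k2 *: (f - P *m a t)) ->
      exists2 v, is_derive t 1 (fun s => agent_energy P k2 eps (a s) (b s)) v &
        v <= - l * agent_energy P k2 eps (a t) (b t) + K * dot f f].
Proof.
move=> pdP k10 k20; have [p0 p00 HP] := pd_coercive pdP.
have PP x : p0 ^+ 2 * dot x x <= dot (P *m x) (P *m x).
  exact: coercive_mulmx_ge (HP x).
have PQ x : p0 * dot x (P *m x) <= dot (P *m x) (P *m x).
  have h := dot_young x (P *m x) p00; have h2 := HP x.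
  have h3 : dot x (P *m x) <= p0^-1 * dot (P *m x) (P *m x) by lra.
  by rewrite -ler_pdivlMl.
(* Collects the multiples of eps |P a|^2 caused by the cross term: from (P a).b, from a.(P a) and
   from a.f, in this order. *)
pose D := k1 ^+ 2 + k2 / p0 + k2 / (2 * p0 ^+ 2).
have D0 : 0 < D.
  by rewrite addr_gt0 ?divr_gt0 ?mulr_gt0 ?exprn_gt0// addr_gt0 ?divr_gt0 ?exprn_gt0.
(* The first bound keeps those terms below a quarter of the dissipation k1 k2 |P a|^2; the other two
   keep the energy coercive. *)
pose eps := Num.min (k1 * k2 / (4 * D)) (Num.min (k2 * p0 / 2) (1 / 2)).
have eps0 : 0 < eps.
  by rewrite !lt_min; apply/and3P; split; rewrite divr_gt0 ?mulr_gt0.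
have eps1 : eps * D <= k1 * k2 / 4.
  have : eps <= k1 * k2 / (4 * D) by rewrite ge_min lexx.
  rewrite invfM mulrA ler_pdivlMr// => h; exact: h.
have eps2 : eps <= k2 * p0 / 2 by rewrite !ge_min lexx !orbT.
have eps3 : eps <= 1 / 2 by rewrite !ge_min lexx !orbT.
pose c1 := Num.min (k2 * p0 / 4) 4^-1.
have c10 : 0 < c1 by rewrite lt_min divr_gt0 ?mulr_gt0//= invr_gt0.
have c11 : c1 <= k2 * p0 / 4 by rewrite ge_min lexx.
have c12 : c1 <= 4^-1 by rewrite ge_min lexx orbT.
pose c2 := k2 * (1 + mxsq P) + 1.
have P1 : 0 < 1 + mxsq P by rewrite ltr_wpDr// mxsq_ge0.
have c20 : 0 < c2 by rewrite addr_gt0// mulr_gt0.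
pose l0 := Num.min (k1 * k2 / 2 * p0 ^+ 2) (eps / 2).
have l00 : 0 < l0 by rewrite lt_min !divr_gt0// !mulr_gt0 ?invr_gt0 ?exprn_gt0.
have l01 : l0 <= k1 * k2 / 2 * p0 ^+ 2 by rewrite ge_min lexx.
have l02 : l0 <= eps / 2 by rewrite ge_min lexx orbT.
pose K := k1 * k2 + 2 * k2 ^+ 2 / eps + 2 * eps * k1 ^+ 2 + eps * k2 / 2.
have bounds a b : c1 * (dot a a + dot b b) <= agent_energy P k2 eps a b <=
    c2 * (dot a a + dot b b).
  have y1 := dot_young a b (@ltr01 R); have y2 := dot_youngN a b (@ltr01 R).
  have a0 := dot_ge0 a; have b0 := dot_ge0 b; have h1 := HP a.
  have h2 : dot a (P *m a) <= (1 + mxsq P) * dot a a.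
    by apply: le_trans (quad_le P a); exact: ler_norm.
  have e1 : eps * (2 * dot a b) <= eps * (dot a a + dot b b).
    by rewrite ler_pM2l//; move: y1; rewrite invr1 !mul1r.
  have e2 : - (eps * (dot a a + dot b b)) <= eps * (2 * dot a b).
    by rewrite -mulrN ler_pM2l//; move: y2; rewrite invr1 !mul1r; lra.
  have q1 : k2 * (p0 * dot a a) <= k2 * dot a (P *m a) by rewrite ler_pM2l.
  have q2 : k2 * dot a (P *m a) <= k2 * ((1 + mxsq P) * dot a a) by rewrite ler_pM2l.
  have r1 : eps * dot a a <= k2 * p0 / 2 * dot a a by rewrite ler_wpM2r.
  have r2 : eps * dot b b <= 1 / 2 * dot b b by rewrite ler_wpM2r.
  have r3 : eps * dot a a <= 1 / 2 * dot a a by rewrite ler_wpM2r.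
  have s1 : c1 * dot a a <= k2 * p0 / 4 * dot a a by rewrite ler_wpM2r.
  have s2 : c1 * dot b b <= 4^-1 * dot b b by rewrite ler_wpM2r.
  have kp : 0 <= k2 * (1 + mxsq P) by rewrite mulr_ge0 ?ltW.
  have s3 : 0 <= k2 * (1 + mxsq P) * dot b b by exact: mulr_ge0.
  have s4 : 0 <= k2 * (1 + mxsq P) * dot a a by exact: mulr_ge0.
  by rewrite /agent_energy /c2; apply/andP; split; lra.
exists eps, c1, c2, (l0 / c2), K; split=> //.
- rewrite c10; apply: le_trans c12 _.
  have : 0 <= k2 * (1 + mxsq P) by rewrite mulr_ge0 ?ltW.
  by rewrite /c2; lra.
- by rewrite divr_gt0.
- have ek := mulr_gt0 eps0 k20; have kk := mulr_gt0 k10 k20.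
  have e1 : 0 <= eps * k1 ^+ 2 by rewrite mulr_ge0 ?sqr_ge0// ltW.
  have e2 : 0 <= 2 * k2 ^+ 2 / eps.
    by apply: divr_ge0; [rewrite mulr_ge0 ?sqr_ge0|exact: ltW].
  by rewrite /K -(mulrA 2 eps); lra.
move=> t a b f da db.
have dP : mxder (fun s => P *m a s) t (P *m (b t + k1 *: (f - P *m a t))).
  exact: mxderMl.
have d1 := derZ (k2 / 2) (der_dot da dP).
have d2 := derZ 2^-1 (der_dot db db).
have d3 := derN (derZ eps (der_dot da db)).
have := derD (derD d1 d2) d3.
set v := (X in is_derive _ _ _ X) => dv; exists v; first exact: dv.
clear d1 d2 d3 dP da db dv.
move: (a t) (b t) @v => {}a {}b v.
pose q := P *m a.
have symP x y : dot x (P *m y) = dot (P *m x) y by rewrite dot_mulmxr pdP.1.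
have vE : v = - (k1 * k2 * dot q q) + k1 * k2 * dot q f + k2 * dot b f
    - eps * dot b b + eps * k1 * dot q b - eps * k1 * dot f b
    + eps * k2 * dot a q - eps * k2 * dot a f.
  rewrite /v (symP a (b + _)) -/q.
  rewrite !(dotDl, dotDr, dotZl, dotZr, dotNl, dotNr) (dotC b q) (dotC f q) (dotC b f).
  by field.
(* Budget: of - k1 k2 |q|^2, one quarter pays for q.f and one for the terms in [D]; of - eps |b|^2,
   one half pays for [i2], [i3] and [i4]. The multiples of |f|^2 add up to [K]. *)
have i1 := dot_young q f (_ : 0 < 2^-1); have {}i1 := i1 ltac:(by rewrite invr_gt0).
rewrite invrK in i1.
have i2 : 2 * (k1 * dot q b) <= 2 * (k1 ^+ 2 * dot q q) + 2^-1 * dot b b.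
  have := dot_young (k1 *: q) b (_ : 0 < 2);
    rewrite dotZl [dot (k1 *: q) (k1 *: q)]dotZl dotZr.
  by move=> /(_ ltac:(by [])); rewrite [k1 * (k1 * _)]mulrA -expr2.
have i3 : 2 * (k2 * dot b f) <= eps / 4 * dot b b + 4 * k2 ^+ 2 / eps * dot f f.
  have := dot_young b (k2 *: f) (_ : 0 < eps / 4).
  rewrite dotZr [dot (k2 *: f) (k2 *: f)]dotZl dotZr => /(_ ltac:(by rewrite divr_gt0)) h.
  apply: le_trans h _; rewrite lerD2l le_eqVlt; apply/orP; left; apply/eqP.
  by field; rewrite gt_eqF.
have i4 : - (2 * (k1 * dot f b)) <= 4 * (k1 ^+ 2 * dot f f) + 4^-1 * dot b b.
  have := dot_youngN (k1 *: f) b (_ : 0 < 4);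
    rewrite dotZl [dot (k1 *: f) (k1 *: f)]dotZl dotZr.
  by move=> /(_ ltac:(by [])); rewrite [k1 * (k1 * _)]mulrA -expr2.
have i5 : - (2 * dot a f) <= dot a a + dot f f.
  by have := dot_youngN a f (@ltr01 R); rewrite invr1 !mul1r.
have j1 : dot a a <= dot q q / p0 ^+ 2 by rewrite ler_pdivlMr ?exprn_gt0// mulrC PP.
have j2 : dot a q <= dot q q / p0 by rewrite ler_pdivlMr// mulrC PQ.
have m1 : k1 * k2 * (2 * dot q f) <= k1 * k2 * (2^-1 * dot q q + 2 * dot f f).
  by rewrite ler_pM2l// mulr_gt0.
have m2 := ler_wpM2l (ltW eps0) i2.
have m4 := ler_wpM2l (ltW eps0) i4.
have m5 := ler_wpM2l (ltW (mulr_gt0 eps0 k20)) i5.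
have m6 := ler_wpM2l (ltW (mulr_gt0 eps0 k20)) j1.
have m7 := ler_wpM2l (ltW (mulr_gt0 eps0 k20)) j2.
have m8 := ler_wpM2r (dot_ge0 q) eps1.
have DE : eps * D * dot q q = eps * (k1 ^+ 2 * dot q q) +
    eps * k2 * (dot q q / p0) + eps * k2 * (dot q q / p0 ^+ 2) / 2.
  by rewrite /D; field; rewrite gt_eqF.
have main : v <= - (k1 * k2 / 2 * dot q q) - eps / 2 * dot b b + K * dot f f.
  rewrite vE /K; rewrite DE in m8.
  move: m1 m2 i3 m4 m5 m6 m7 m8; lra.
have n1 : l0 * dot a a <= k1 * k2 / 2 * dot q q.
  have := PP a; rewrite -/q => h.
  apply: le_trans (ler_wpM2r (dot_ge0 a) l01) _.
  rewrite -(mulrA (k1 * k2 / 2)); apply: ler_wpM2l h.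
  by rewrite divr_ge0// mulr_ge0 ?ltW.
have n2 := ler_wpM2r (dot_ge0 b) l02.
have n3 : l0 / c2 * agent_energy P k2 eps a b <= l0 * (dot a a + dot b b).
  rewrite mulrAC ler_pdivrMr// -mulrA ler_pM2l// mulrC.
  by case/andP: (bounds a b).
by rewrite mulNr; lra.
Qed.

End agents.

(** * The coupled error system *)

Section error_system.
Context {R : realType}.

(** The inverse of a sum of inverses serves as a lower bound; the summand 1 covers an empty
    family. *)
Lemma uniform_lb m (c : 'I_m -> R) : (forall k, 0 < c k) ->
  exists2 c0, 0 < c0 & forall k, c0 <= c k.
Proof.
move=> c0; exists (\sum_k (c k)^-1 + 1)^-1 => [|k].
  by rewrite invr_gt0 ltr_wpDl// sumr_ge0// => k _; rewrite invr_ge0 ltW.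
rewrite -[leRHS]invrK lef_pV2 ?posrE ?invr_gt0//; last first.
  by rewrite ltr_wpDl// sumr_ge0// => i _; rewrite invr_ge0 ltW.
rewrite (bigD1 k)//= -addrA lerDl addr_ge0// sumr_ge0// => i _.
by rewrite invr_ge0 ltW.
Qed.

Lemma uniform_ub m (c : 'I_m -> R) : (forall k, 0 < c k) ->
  exists2 c0, 0 < c0 & forall k, c k <= c0.
Proof.
move=> c0; exists (\sum_k c k + 1) => [|k].
  by rewrite ltr_wpDl// sumr_ge0// => k _; rewrite ltW.
by rewrite (bigD1 k)//= -addrA lerDl addr_ge0// sumr_ge0// => i _; rewrite ltW.
Qed.

(** Nothing is asked of [U] at [t0] itself: it will involve inverses of Riccati solutions,
    controlled only at positive times, while [t0] may be 0. Square roots halve the rate; the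
    prefactor may stay c2 / c1 because it is at least 1. *)
Lemma lyapunov_ges N (x : R -> 'cV[R]_N) (U : R -> R) (c1 c2 l t0 t : R) :
  0 < c1 <= c2 -> 0 < l -> t0 <= t ->
  {within `[t0, +oo[, continuous (fun s => dot (x s) (x s))} ->
  (forall s, t0 < s -> c1 * dot (x s) (x s) <= U s <= c2 * dot (x s) (x s)) ->
  (forall s, t0 < s -> exists2 v, is_derive s 1 U v & v <= - l * U s) ->
  enorm (x t) <= c2 / c1 * expR (- (l / 2 * (t - t0))) * enorm (x t0).
Proof.
move=> /andP[c10 c12] l0; have c20 := lt_le_trans c10 c12.
have r1 : 1 <= c2 / c1 by rewrite ler_pdivlMr// mul1r.
rewrite le_eqVlt => /predU1P[<- _ _ _|t0t cx Ux dU].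
  by rewrite subrr mulr0 oppr0 expR0 mulr1 ler_peMl// enorm_ge0.
(* Arranged so that the left side is free of [s] and the right side, in which [U] no longer occurs,
   is continuous at [t0]. *)
have key s : t0 < s < t ->
    c1 / c2 * expR (l * (t - t0)) * dot (x t) (x t) <= expR (l * (s - t0)) * dot (x s) (x s).
  move=> /andP[t0s st].
  have h : U t <= expR (- (l * (t - s))) * U s.
    by apply: exp_decay; [exact: ltW|move=> r /andP[sr _]; exact/dU/(lt_le_trans t0s)].
  have /andP[h1 _] := Ux t t0t; have /andP[_ h2] := Ux s t0s.
  have h3 := le_trans h1 (le_trans h (ler_wpM2l (expR_ge0 _) h2)).
  have E : expR (l * (s - t0)) = expR (l * (t - t0)) * expR (- (l * (t - s))).
    by rewrite -expRD; congr expR; ring.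
  rewrite E -(ler_pM2l c20).
  have -> : c2 * (c1 / c2 * expR (l * (t - t0)) * dot (x t) (x t)) =
      expR (l * (t - t0)) * (c1 * dot (x t) (x t)) by field; rewrite gt_eqF.
  have -> : c2 * (expR (l * (t - t0)) * expR (- (l * (t - s))) * dot (x s) (x s)) =
      expR (l * (t - t0)) * (expR (- (l * (t - s))) * (c2 * dot (x s) (x s))) by ring.
  by rewrite ler_pM2l ?expR_gt0.
have cE : {within `[t0, +oo[, continuous (fun s => expR (l * (s - t0)))}.
  apply: continuous_subspaceT => s.
  apply: (@continuous_comp _ _ _ (fun s => l * (s - t0)) expR);
    last exact: continuous_expR.
  exact: der_continuous (derZ l (derD (der_id s) (der_cst (- t0) s))).
have := right_limit_le t0t (within_continuousM cE cx) key.
rewrite subrr mulr0 expR0 mul1r => h.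
have h2 : dot (x t) (x t) <=
    c2 / c1 * (expR (- (l / 2 * (t - t0))) ^+ 2 * dot (x t0) (x t0)).
  have EE : expR (- (l / 2 * (t - t0))) ^+ 2 * expR (l * (t - t0)) = 1.
    by rewrite expr2 -!expRD -[RHS]expR0; congr expR; field.
  move: EE h; set E2 := _ ^+ 2; set G := expR _ => EE h.
  have E20 : 0 <= c2 / c1 * E2 by rewrite mulr_ge0 ?divr_ge0 ?sqr_ge0 ?ltW.
  have := ler_wpM2l E20 h; rewrite (mulrA (c2 / c1)).
  have -> : c2 / c1 * E2 * (c1 / c2 * G * dot (x t) (x t)) = E2 * G * dot (x t) (x t).
    by field; rewrite !gt_eqF.
  by rewrite EE mul1r.
rewrite -(@ler_pXn2r _ 2) ?nnegrE ?enorm_ge0//; last first.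
  by rewrite !mulr_ge0 ?enorm_ge0 ?expR_ge0 ?invr_ge0 ?ltW.
rewrite 2!exprMn !enorm_sqr -mulrA; apply: le_trans h2 _.
rewrite ler_wpM2r ?mulr_ge0 ?sqr_ge0 ?dot_ge0// expr2.
by apply: ler_peMl => //; exact: le_trans r1.
Qed.

(** The innovation equals f - P a. On a PE edge the weight is the identity, so the estimate splits
    into the true relative position and its error; on any other edge the weight annihilates the true
    relative position, so the zero estimate acts as an exact one. *)
Lemma agent_error_der d n m (src tgt : 'I_m -> 'I_n) (p v u : 'I_n -> R -> 'cV[R]_d)
    (ko1 ko2 t0 t : R) (pb : 'I_m -> R -> 'cV[R]_d) (ph vh : R -> 'cV[R]_(n * d)) :
  (forall k, ~ PE (edge_bearing src tgt p k) ->
    constant_direction (edge_bearing src tgt p k)) ->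
  (forall i, mxder (p i) t (v i t)) -> (forall i, mxder (v i) t (u i t)) ->
  (forall k, ~ PE (edge_bearing src tgt p k) -> pb k t = 0) ->
  distributed_observer src tgt p u ko1 ko2 t0 pb ph vh -> 0 <= t0 -> t0 < t ->
  let a s := ph s - stack (p^~ s) in let b s := vh s - stack (v^~ s) in
  let f := (Hbar R d src tgt)^T *m stack (fun k =>
    if `[< PE (edge_bearing src tgt p k) >] then pb k t - edge_diff src tgt p k t else 0) in
  let P := stiffness src tgt p in
  mxder a t (b t + ko1 *: (f - P *m a t)) /\ mxder b t (ko2 *: (f - P *m a t)).
Proof.
move=> nPE dp dv pb0 obs t00 t0t a b f P.
have t_ge0 : 0 <= t by rewrite ltW// (le_lt_trans t00).
set H := Hbar R d src tgt in f *.
pose Z := H^T *m Sigma_bar src tgt p t *m (stack (pb^~ t) - H *m ph t) +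
  leader_C R d n *m (stack (p^~ t) - ph t).
have ZE : Z = f - P *m a t.
  rewrite /Z /P /stiffness mulmxDl opprD addrA; congr (_ + _); last first.
    by rewrite -mulmxN opprB.
  rewrite Sigma_bar_constant// -!mulmxA -/H -mulmxBr; congr (_ *m _).
  apply: blk_inj => k; rewrite blkD blkN blk_stack !blk_blkdiag blkD blkN blk_stack.
  rewrite !blk_Hbar !blkD !blkN !blk_stack.
  case: asboolP => [PEk|nPEk].
    rewrite !mul1mx /edge_diff; apply/matrixP => i j; rewrite !mxE; ring.
  (* The relative position is inserted for free, because the constant bearing's projection sends it
     to 0. *)
  have [y yE] := nPE k nPEk; rewrite pb0//.
  have gE : edge_bearing src tgt p k 0 = edge_bearing src tgt p k t by rewrite !yE.
  have : orth_proj (edge_bearing src tgt p k 0) *m (p (tgt k) t - p (src k) t) = 0.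
    by rewrite gE; exact: orth_proj_bearing.
  move: (orth_proj _) => G G0.
  rewrite !sub0r -mulmxN.
  set A := - (blk (ph t) _ - _); rewrite -[LHS]addr0 -G0 -mulmxDr.
  by congr (_ *m _); apply/matrixP => i j; rewrite /A !mxE; ring.
have dx := solution_mxder obs t0t.
set F := (X in mxder _ _ X) in dx.
have FE : F = col_mx (vh t + ko1 *: Z) (stack (u^~ t) + ko2 *: Z).
  rewrite /F -/H -/Z /integrator_A /integrator_B mul_block_col !mul_col_mx.
  by rewrite !mul0mx !mul1mx !mul_scalar_mx !add_col_mx !add0r !addr0.
have dph : mxder ph t (vh t + ko1 *: Z).
  have := mxder_usub dx; rewrite FE col_mxKu.
  by rewrite (_ : (fun s => _) = ph)//; apply/funext => s; rewrite col_mxKu.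
have dvh : mxder vh t (stack (u^~ t) + ko2 *: Z).
  have := mxder_dsub dx; rewrite FE col_mxKd.
  by rewrite (_ : (fun s => _) = vh)//; apply/funext => s; rewrite col_mxKd.
rewrite -ZE; split.
  apply: mxder_eq (mxderB dph (mxder_stack dp)) _.
  by rewrite /b addrAC.
apply: mxder_eq (mxderB dvh (mxder_stack dv)) _.
by rewrite addrAC subrr add0r.
Qed.

End error_system.

(** * The composite Lyapunov function *)

Theorem theorem2 (R : realType) (d n m : nat)
    (d_ge2 : (2 <= d)%N) (n_ge2 : (2 <= n)%N)
    (e : rel 'I_n) (graph_e : simple_graph e)
    (src tgt : 'I_m -> 'I_n) (orient : edge_orientation e src tgt)
    (p v u : 'I_n -> R -> 'cV[R]_d)
    (dyn_p : forall i, solution 0 (p i) (v i))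
    (dyn_v : forall i, solution 0 (v i) (u i))
    (bounded_pvu : forall i,
       [/\ bounded_signal (p i), bounded_signal (v i) & bounded_signal (u i)])
    (bearings_defined : forall i j, e i j ->
       forall t, 0 <= t -> p j t - p i t != 0)
    (formation_BPE : BPE e src tgt p)
    (nonPE_constant : forall k, ~ PE (edge_bearing src tgt p k) ->
       constant_direction (edge_bearing src tgt p k))
    (kappa : 'I_m -> R) (Q : 'I_m -> 'M[R]_d) (S : 'I_m -> 'M[R]_(d + d))
    (M : 'I_m -> R -> 'M[R]_(d + d))
    (riccati : forall k, PE (edge_bearing src tgt p k) ->
       [/\ 2^-1 <= kappa k, pdmx (Q k), pdmx (S k) &
           riccati_solution (edge_bearing src tgt p k) (Q k) (S k) (M k)])
    (ko1 ko2 : R) (ko1_gt0 : 0 < ko1) (ko2_gt0 : 0 < ko2) :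
  globally_exponentially_stable
    (error_trajectory src tgt p v u kappa Q M ko1 ko2).
Proof.
have n_gt0 : (0 < n)%N by exact: leq_trans n_ge2.
have p_cont i : mxcont 0 (p i) by exact: solution_mxcont (dyn_p i).
have v_cont i : mxcont 0 (v i) by exact: solution_mxcont (dyn_v i).
have dp i (t : R) : 0 < t -> mxder (p i) t (v i t) by exact: solution_mxder (dyn_p i).
have dv i (t : R) : 0 < t -> mxder (v i) t (u i t) by exact: solution_mxder (dyn_v i).
have [eps [a1 [a2 [la [Ka [a12 la0 Ka0 Vbnd Vder]]]]]] :=
  agent_lyapunov (stiffness_pd n_gt0 orient p_cont bearings_defined nonPE_constant
    formation_BPE) ko1_gt0 ko2_gt0.
have ge k : exists cl : R * R * R, [/\ 0 < cl.1.1, 0 < cl.1.2, 0 < cl.2 &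
    PE (edge_bearing src tgt p k) ->
    (forall (t : R) x, 0 < t -> cl.1.1 * dot x x <= dot x (invmx (M k t) *m x) <=
        cl.1.2 * dot x x) /\
    (forall (t : R) (x : R -> 'cV[R]_(d + d)), 0 < t ->
      mxder x t (integrator_A R d *m x t
        - kappa k *: (M k t *m (output_C (edge_bearing src tgt p k t))^T *m Q k)
          *m output_C (edge_bearing src tgt p k t) *m x t) ->
      exists2 b, is_derive t 1 (fun s : R => dot (x s) (invmx (M k s) *m x s)) b &
        b <= - cl.2 * dot (x t) (invmx (M k t) *m x t))].
  (* Edges without a relative observer get dummy constants 1, so that the bounds below can be
     uniform over all edges. *)
  have [PEk|nPEk] := pselect (PE (edge_bearing src tgt p k));
    last by exists (1, 1, 1).
  have [k2 pdQ pdS ric] := riccati k PEk.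
  have [c1 [c2 [l [c10 c20 l0 h1 h2]]]] := edge_lyapunov
    (edge_bearing_unit orient bearings_defined k)
    (edge_bearing_cont (k := k) orient p_cont bearings_defined) PEk k2 pdQ pdS ric.
  by exists (c1, c2, l).
have {ge} [cl Hcl] := choice ge.
have [w1 w10 Hw1] : exists2 c, 0 < c & forall k, c <= (cl k).1.1.
  by apply: uniform_lb => k; have [] := Hcl k.
have [w2 w20 Hw2] : exists2 c, 0 < c & forall k, (cl k).1.2 <= c.
  by apply: uniform_ub => k; have [] := Hcl k.
have [lw lw0 Hlw] : exists2 c, 0 < c & forall k, c <= (cl k).2.
  by apply: uniform_lb => k; have [] := Hcl k.
move/andP: a12 => [a10 a12].
(* The input [f] is H^T applied to the relative position errors, so Ka |f|^2 is at most [KH] times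
   the sum of the squared edge errors. *)
pose KH := Ka * mxsq (Hbar R d src tgt)^T.
have KH0 : 0 <= KH by rewrite mulr_ge0// mxsq_ge0.
(* Chosen so that nu lw / 2 >= KH / w1: half of the edges' dissipation absorbs the coupling and the
   other half gives the decay. The summand 1 makes [nu] at least 1, as the lower bound on [U]
   requires. *)
pose nu := 2 * KH / (w1 * lw) + 1.
have nu1 : 1 <= nu.
  by rewrite lerDr; apply: divr_ge0; rewrite mulr_ge0// ltW.
have nu0 : 0 < nu by exact: lt_le_trans nu1.
pose l := Num.min la (lw / 2).
have l0 : 0 < l by rewrite lt_min la0 divr_gt0.
have lla : l <= la by rewrite ge_min lexx.
have llw : l <= lw / 2 by rewrite ge_min lexx orbT.
pose c1 := Num.min a1 w1; pose c2 := a2 + nu * w2.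
have c10 : 0 < c1 by rewrite lt_min a10.
have c12 : c1 <= c2.
  have : c1 <= a1 by rewrite ge_min lexx.
  have : 0 < nu * w2 by exact: mulr_gt0.
  by rewrite /c2; lra.
have c20 := lt_le_trans c10 c12.
exists (c2 / c1), (l / 2); split; rewrite ?divr_gt0// => t0 err t00.
move=> [pb [vb [ph [vh [est obs errE]]]]] t t0t.
pose a s := ph s - stack (p^~ s); pose b s := vh s - stack (v^~ s).
pose x k s : 'cV[R]_(d + d) := if `[< PE (edge_bearing src tgt p k) >]
  then col_mx (pb k s - edge_diff src tgt p k s) (vb k s - edge_diff src tgt v k s)
  else 0.
pose X s := \sum_k dot (x k s) (x k s).
(* [err] is only known from [t0] on; [y] is the same error in closed form, on which continuity and
   derivatives can be studied. *)
pose y s := col_mx (agent_error p v ph vh s) (edge_error src tgt p v pb vb s).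
have yE s : dot (y s) (y s) = dot (a s) (a s) + dot (b s) (b s) + X s.
  rewrite /y /agent_error !dot_col_mx [dot (edge_error _ _ _ _ _ _ _) _]dot_blk.
  congr (_ + _).
  by apply: eq_bigr => k _; rewrite blk_stack.
rewrite !errE//.
pose W k s := dot (x k s) (invmx (M k s) *m x k s).
pose V s := agent_energy (stiffness src tgt p) ko2 eps (a s) (b s).
have Wbnd k (s : R) : t0 < s ->
    w1 * dot (x k s) (x k s) <= W k s <= w2 * dot (x k s) (x k s).
  move=> t0s; have s0 : 0 < s by exact: le_lt_trans t0s.
  rewrite /W /x; case: asboolP => [PEk|_]; last by rewrite mulmx0 dot0r !mulr0 lexx.
  have [_ _ _ /(_ PEk)[+ _]] := Hcl k; move: (col_mx _ _) => z /(_ s z s0)/andP[h1 h2].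
  apply/andP; split; [apply: le_trans h1|apply: (le_trans h2)];
  by rewrite ler_wpM2r ?dot_ge0.
have dpd k (s : R) : 0 < s -> mxder (edge_diff src tgt p k) s (edge_diff src tgt v k s).
  by move=> s0; apply: mxderB; exact: dp.
have dvd k (s : R) : 0 < s -> mxder (edge_diff src tgt v k) s (edge_diff src tgt u k s).
  by move=> s0; apply: mxderB; exact: dv.
have Wder k (s : R) : t0 < s -> exists2 w, is_derive s 1 (W k) w & w <= - lw * W k s.
  move=> t0s; have s0 : 0 < s by exact: le_lt_trans t0s.
  have := Wbnd k s t0s; rewrite /W /x; case: asboolP => [PEk|_] Wb; last first.
    exists 0; last by rewrite dot0l mulr0.
    rewrite (_ : (fun s => _) = fun=> 0); first exact: der_cst.
    by apply/funext => r; rewrite dot0l.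
  have [_ _ _ /(_ PEk)[_ Hder]] := Hcl k.
  have := relative_error_der ((est k).1 PEk) t0s (dpd k s s0) (dvd k s s0)
    (orth_proj_bearing _).
  move=> /(Hder _ _ s0)[w dw wle]; exists w => //; apply: le_trans wle _.
  (* Passing from the edge's own rate to the uniform rate [lw] needs W_k >= 0. *)
  rewrite !mulNr lerN2 ler_wpM2r//; move/andP: Wb => [+ _]; apply: le_trans.
  by rewrite mulr_ge0 ?dot_ge0// ltW.
have Vd (s : R) : t0 < s -> exists2 w, is_derive s 1 V w & w <= - la * V s + KH * X s.
  move=> t0s; have s0 : 0 < s by exact: le_lt_trans t0s.
  have pb0 k : ~ PE (edge_bearing src tgt p k) -> pb k s = 0.
    by move=> nPEk; have [_ /(_ nPEk s (ltW t0s))[]] := est k.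
  have [da db] := agent_error_der nonPE_constant (fun i => dp i s s0)
    (fun i => dv i s s0) pb0 obs t00 t0s.
  have [w dw wle] := Vder _ _ _ _ da db; exists w => //.
  apply: le_trans wle _; rewrite lerD2l /KH -mulrA ler_wpM2l//.
  apply: le_trans (dot_mulmx_le _ _) _; rewrite ler_wpM2l ?mxsq_ge0//.
  rewrite dot_blk; apply: ler_sum => k _; rewrite blk_stack /x.
  by case: asboolP => _; rewrite ?dot0r// dot_col_mx lerDl dot_ge0.
pose U s := V s + nu * \sum_k W k s.
have SWbnd (s : R) : t0 < s -> w1 * X s <= \sum_k W k s <= w2 * X s.
  by move=> t0s; rewrite !mulr_sumr; apply/andP; split; apply: ler_sum => k _;
    have /andP[] := Wbnd k s t0s.
have X0 s : 0 <= X s by apply: sumr_ge0 => k _; exact: dot_ge0.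
apply: (@lyapunov_ges _ _ y U c1 c2 l) => //; first by rewrite c10.
- suff cy : mxcont t0 y by exact: within_dot.
  apply: mxcont_col.
    apply: mxcontB_col (solution_mxcont obs) _ _; apply: mxcont_stack => i.
      exact: mxcontW t00 (p_cont i).
    exact: mxcontW t00 (v_cont i).
  apply: (mxcont_stack (x := x)) => k; rewrite /x.
  case: asboolP => [PEk|_]; last exact: mxcont_cst.
  apply: mxcontB_col (solution_mxcont ((est k).1 PEk)) _ _;
    (apply: mxcontD; last apply: mxcontN); apply: mxcontW t00 _;
    by [exact: p_cont|exact: v_cont].
- move=> s t0s; rewrite yE; have /andP[h1 h2] := SWbnd s t0s.
  have /andP[h3 h4] := Vbnd (a s) (b s); rewrite -/(V s) in h3 h4.
  have ab0 : 0 <= dot (a s) (a s) + dot (b s) (b s) by rewrite addr_ge0 ?dot_ge0.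
  have X0s := X0 s; move: (_ + dot (b s) _) ab0 h3 h4 => ab ab0 h3 h4.
  have m1 : c1 * ab <= a1 * ab by rewrite ler_wpM2r// ge_min lexx.
  have m2 : c1 * X s <= w1 * X s by rewrite ler_wpM2r// ge_min lexx orbT.
  have SW0 : 0 <= \sum_k W k s by apply: le_trans h1; rewrite mulr_ge0// ltW.
  have m3 : \sum_k W k s <= nu * \sum_k W k s by exact: ler_peMl.
  have m4 : nu * \sum_k W k s <= nu * (w2 * X s) by rewrite ler_pM2l.
  have m5 : 0 <= nu * w2 * ab by rewrite !mulr_ge0// ltW.
  have m6 : 0 <= a2 * X s by rewrite mulr_ge0// (le_trans (ltW a10)).
  by rewrite /U /c2; apply/andP; split; lra.
- move=> s t0s; have [w dw wle] := Vd s t0s.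
  have /choice[w' Hw'] : forall k, exists w' : R, is_derive s 1 (W k) w' /\ w' <= - lw * W k s.
    by move=> k; have [w' ? ?] := Wder k s t0s; exists w'.
  exists (w + nu * \sum_k w' k).
    by apply: derD dw _; apply: derZ; apply: der_sum => k; exact: (Hw' k).1.
  have h0 : \sum_k w' k <= - lw * \sum_k W k s.
    by rewrite mulr_sumr; apply: ler_sum => k _; exact: (Hw' k).2.
  have /andP[h1 _] := SWbnd s t0s; have /andP[h3 _] := Vbnd (a s) (b s).
  have V0 : 0 <= V s.
    apply: le_trans h3; rewrite mulr_ge0// ?addr_ge0 ?dot_ge0//; exact: ltW.
  have SW0 : 0 <= \sum_k W k s by apply: le_trans h1; rewrite mulr_ge0// ltW.
  have m1 : l * V s <= la * V s by rewrite ler_wpM2r.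
  have m2 : nu * \sum_k w' k <= nu * (- lw * \sum_k W k s) by rewrite ler_pM2l.
  have m3 : KH * X s <= nu * (lw / 2 * \sum_k W k s).
    have m4 : KH * X s <= KH * ((\sum_k W k s) / w1).
      by apply: ler_wpM2l => //; rewrite ler_pdivlMr// mulrC.
    apply: le_trans m4 _; have -> : nu * (lw / 2 * \sum_k W k s) =
        KH * ((\sum_k W k s) / w1) + lw / 2 * \sum_k W k s.
      by rewrite /nu; field; rewrite !gt_eqF.
    by rewrite lerDl mulr_ge0// divr_ge0// ltW.
  have m5 : l * (nu * \sum_k W k s) <= lw / 2 * (nu * \sum_k W k s).
    by rewrite ler_wpM2r// mulr_ge0// ltW.
  by rewrite /U; lra.
Qed.
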